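(* Let $X$ be a random variable taking values in $\mathbb{N}_0$ with $\lambda=\mathbb{E}[X]\in(0,\infty)$, and let $P_\lambda$ be a Poisson random variable with mean $\lambda$. Assume there exists a random variable $Z$ defined on the same probability space as $X$, with values in $\mathbb{Z}$, such that $$ i\,\mathbb{P}(X=i)=\lambda\,\mathbb{P}(X+Z=i-1),\qquad i\in\mathbb{N}. $$ Then $$ d_{TV}(X,P_\lambda)\le (1\wedge\lambda)\,\mathbb{E}[|Z|]\qquad\text{and}\qquad d_W(X,P_\lambda)\le (1.1437\sqrt{\lambda}\wedge\lambda)\,\mathbb{E}[|Z|]. $$ Furthermore, for all $m\in\mathbb{N}_0$, $$ |\mathbb{P}(X=0)-\mathbb{P}(P_\lambda=0)|\le \frac{m!}{\lambda^m}\mathbb{E}[|Z|]+\sum_{k=0}^{m-1}\Big(\frac{\lambda}{k+1}\wedge\frac{k!}{\lambda^k}\Big)\mathbb{E}\big[|Z|\mathbf{1}\{X-Z_-=k\}\big], $$ and for all $v\in\mathbb{N}$, $$ |\mathbb{P}(X\le v)-\mathbb{P}(P_\lambda\le v)|\le \frac{(v+1)^2}{\lambda}\mathbb{E}[|Z|]+\mathbb{E}\big[|Z|\mathbf{1}\{X-Z_-\le v\}\big]. $$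
   Context: $\mathbb{N}=\{1,2,\dots\}$, $\mathbb{N}_0=\mathbb{N}\cup\{0\}$, $a\wedge b=\min\{a,b\}$, and $W_+=\max\{W,0\}$, $W_-=\max\{-W,0\}$ are the positive and negative parts of a random variable $W$. For $\mathbb{N}_0$-valued $X$ the total variation distance is $d_{TV}(X,P_\lambda)=\sup_{A\subset\mathbb{N}_0}|\mathbb{P}(X\in A)-\mathbb{P}(P_\lambda\in A)|$ and the Wasserstein distance is $d_W(X,P_\lambda)=\sup_{g\in\mathrm{Lip}(1)}|\mathbb{E}[g(X)]-\mathbb{E}[g(P_\lambda)]|$, where $\mathrm{Lip}(1)$ is the set of Lipschitz functions $g:\mathbb{N}_0\to\mathbb{R}$ with Lipschitz constant at most $1$. An empty sum is $0$. *)

(* Defs.v *)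
From HB Require Import structures.
From mathcomp Require Import all_boot all_order all_algebra.
From mathcomp Require Import all_classical all_reals all_analysis.

Set Implicit Arguments.
Unset Strict Implicit.
Unset Printing Implicit Defensive.

Import Order.TTheory GRing.Theory Num.Theory.
Import numFieldNormedType.Exports.

Local Open Scope classical_set_scope.
Local Open Scope ring_scope.

(* The discrete sigma-algebra on int, as the library does for nat. *)
HB.instance Definition _ := isPointed.Build int 0.
HB.instance Definition _ := @isMeasurable.Build default_measure_display
  int discrete_measurable discrete_measurable0
  discrete_measurableC discrete_measurableU.

(* The second argument of poisson_prob is not used by the library. *)
Definition is_poisson d (T : measurableType d) (R : realType)
    (Q : probability T R) (Y : {RV Q >-> nat}) (lambda : R) : Prop :=
  forall A : set nat, distribution Q Y A = poisson_prob lambda 0%N A.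

(* The two variables may live on different probability spaces. *)
Definition dTV d d' (T : measurableType d) (T' : measurableType d')
    (R : realType) (P : probability T R) (Q : probability T' R)
    (X : {RV P >-> nat}) (Y : {RV Q >-> nat}) : \bar R :=
  ereal_sup [set `|P (X @^-1` A) - Q (Y @^-1` A)|%E | A in [set: set nat]].

Definition Lip1 (R : realType) : set (nat -> R) :=
  [set g : nat -> R | forall x y : nat, `|g x - g y| <= `|x%:R - y%:R : R|].

(* Meaningful when X and Y have finite mean, so that all the expectations
   below are finite. *)
Definition dW d d' (T : measurableType d) (T' : measurableType d')
    (R : realType) (P : probability T R) (Q : probability T' R)
    (X : {RV P >-> nat}) (Y : {RV Q >-> nat}) : \bar R :=
  ereal_sup [set `|'E_P[g \o X] - 'E_Q[g \o Y]|%E | g in @Lip1 R].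

(* Main.v *)
Require Import Defs.
From mathcomp Require Import all_boot all_order all_algebra.
From mathcomp Require Import all_classical all_reals all_analysis.
From mathcomp Require Import measurable_realfun ring lra zify.

Set Implicit Arguments.
Unset Strict Implicit.
Unset Printing Implicit Defensive.

Import Order.TTheory GRing.Theory Num.Theory.
Import numFieldNormedType.Exports.

Local Open Scope classical_set_scope.
Local Open Scope ring_scope.

(** Let [N] be a Poisson variable of mean [lam]. The proof is Stein's method: for
    a test function [g], the Stein equation
      [lam * f i - i * f (i - 1) = g i - E g(N)]
    has the explicit solution [stein]. The assumption on [Z] says that [X + Z]
    has the law of [X - 1] under the probability biased by [X], so that
    [E (X f(X - 1)) = lam * E f(X + Z)] and therefore
      [E g(X) - E g(N) = lam * E (f(X) - f(X + Z))].
    Going from [X] to [X + Z] takes [|Z|] unit steps, the lowest of which starts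
    at [min(X, X + Z) = X - Z^-]; this is [stein_bound]. All four estimates
    follow from bounds on the increments of [f], for suitable [g].

    For [1]-Lipschitz [g], among them all indicator functions, the slope of [f]
    is a combination of the parts of [g] on both sides of a point
    ([stein_increment]), and is largest for [g j = - |j - n|]. It is thus at most
      [2 * E (n - N)^+ * E (N - n)^+ / (lam * n * P(N = n))].
    This ratio is twice the integral over [0, 1] of [(1 - s) * P(W_s = n - 1)],
    where [W_s] is the sum of independent Poisson([lam s]) and
    Binomial([n - 1], [1 - s]) variables: the immigration-death process started
    from [n - 1], run for the time [- ln (1 - s)]. Bounding the mass by [1] gives
    slopes at most [1] ([shortfall_excess_le1]); bounding it by
    [1 / sqrt (2 e lam s)], as every mass of a Poisson variable of mean [lam s] is
    ([pois_sqrt_bound]), gives slopes at most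
    [8 / (3 sqrt (2 e lam))] ([shortfall_excess_sqrt]), and
    [8 / (3 sqrt (2 e)) < 1.1437].

    For indicator functions the same formula gives the slope bound [1 / lam]
    ([stein_slope_indic]). For the indicator of [j <= v], the solution is
    nonnegative and nonincreasing from [v] on, so an increment starting at
    [k >= v] is at most [f k] ([stein_step_diff]). The third estimate uses the
    resulting bounds with [v = 0]; the last one uses them for [k > v], and the
    slope bound [1 / lam] for [k <= v]. *)

(** * Differentiation of real functions *)

Section Calculus.
Context {R : realType}.
Implicit Types (x y s c df dg : R) (f g : R -> R).

(** The rules are stated for functions given by their values at a point, the
    shape in which they are met below. *)
Lemma is_derive_mul f g x df dg : is_derive x 1 f df -> is_derive x 1 g dg ->
  is_derive x 1 (fun s => f s * g s) (df * g x + f x * dg).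
Proof.
move=> fx gx; apply: (is_derive_eq (is_deriveM fx gx)).
by rewrite /GRing.scale/=; ring.
Qed.

Lemma is_derive_add f g x df dg : is_derive x 1 f df -> is_derive x 1 g dg ->
  is_derive x 1 (fun s => f s + g s) (df + dg).
Proof. by move=> fx gx; exact: is_deriveD. Qed.

Lemma is_derive_sub f g x df dg : is_derive x 1 f df -> is_derive x 1 g dg ->
  is_derive x 1 (fun s => f s - g s) (df - dg).
Proof. by move=> fx gx; exact: is_deriveB. Qed.

Lemma is_derive_scale f x df c : is_derive x 1 f df ->
  is_derive x 1 (fun s => c * f s) (c * df).
Proof. by move=> fx; exact: is_deriveZ. Qed.

Lemma is_derive_chain f g x df dg : is_derive (g x) 1 f df ->
  is_derive x 1 g dg -> is_derive x 1 (fun s => f (g s)) (dg * df).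
Proof.
move=> fx gx; have h := is_derive1_comp fx gx.
apply: (is_derive_eq h).
by rewrite mulrC.
Qed.

Lemma is_derive_var x : @is_derive R R R x 1 (fun s => s) 1.
Proof. exact: is_derive_id. Qed.

Lemma is_derive_const x c : @is_derive R R R x 1 (fun=> c) 0.
Proof. exact: is_derive_cst. Qed.

Lemma is_derive_monom x n : @is_derive R R R x 1 (fun s => s ^+ n) (n%:R * x ^+ n.-1).
Proof.
apply: DeriveDef; first exact: exprn_derivable.
by rewrite exp_derive /GRing.scale/= mulr1.
Qed.

Lemma derive_le_increment f g a b (df dg : R -> R) : a <= b ->
  (forall x, a <= x <= b -> is_derive x 1 f (df x)) ->
  (forall x, a <= x <= b -> is_derive x 1 g (dg x)) ->
  (forall x, a < x < b -> df x <= dg x) -> f b - f a <= g b - g a.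
Proof.
rewrite le_eqVlt => /predU1P[-> *|ab f' g' fg]; first by rewrite !subrr.
have d x : a <= x <= b -> is_derive x 1 (fun s => g s - f s) (dg x - df x).
  by move=> xab; apply: is_derive_sub; [exact: g'|exact: f'].
have [||c] := @MVT R (fun s => g s - f s) (fun s => dg s - df s) a b ab.
- by move=> x; rewrite in_itv/= => /andP[? ?]; apply: d; rewrite !ltW.
- apply: derivable_within_continuous => x; rewrite in_itv/= => xab.
  by have := d x xab; exact: @ex_derive.
rewrite in_itv/= => cab h; have := fg c cab.
have : 0 < b - a by rewrite subr_gt0.
rewrite /= in h; nra.
Qed.

End Calculus.

(** * The largest value of a Poisson mass *)

Section PoissonMode.
Context {R : realType}.
Implicit Types (x y : R) (r n : nat).

Definition pois x r : R := expR (- x) * (x ^+ r / r`!%:R).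

Lemma fact_neq0 r : r`!%:R != 0 :> R.
Proof. by rewrite pnatr_eq0 -lt0n fact_gt0. Qed.

Lemma poisS x r : r.+1%:R * pois x r.+1 = x * pois x r.
Proof.
rewrite /pois factS natrM exprS; field.
by rewrite fact_neq0 addrC natr1 pnatr_eq0.
Qed.

Lemma pois_gt0 x r : 0 < x -> 0 < pois x r.
Proof.
by move=> x0; rewrite mulr_gt0 ?expR_gt0// divr_gt0 ?exprn_gt0//.
Qed.

Lemma pois_ge0 x r : 0 <= x -> 0 <= pois x r.
Proof. by move=> x0; rewrite mulr_ge0 ?expR_ge0// divr_ge0 ?exprn_ge0. Qed.


Lemma is_derive_expRN x : is_derive x 1 (fun s : R => expR (- s)) (- expR (- x)).
Proof.
have d : is_derive x 1 (fun s : R => - s) (-1) by exact: is_deriveNid.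
by have := is_derive_chain (is_derive_expR (- x)) d; rewrite mulN1r.
Qed.

Lemma is_derive_pois0 x : is_derive x 1 (pois^~ 0%N) (- pois x 0).
Proof.
apply: (is_derive_eq (is_derive_mul (is_derive_expRN x) (is_derive_const x (1 / 0`!%:R)))).
by rewrite mulr0 addr0 mulNr.
Qed.

Lemma is_derive_poisS x r :
  is_derive x 1 (pois^~ r.+1) (pois x r - pois x r.+1).
Proof.
have d := is_derive_mul (is_derive_monom x r.+1)
                        (is_derive_const x (r.+1`!%:R^-1)).
apply: (is_derive_eq (is_derive_mul (is_derive_expRN x) d)).
rewrite /pois mulr0 addr0 /= factS natrM; field.
by rewrite fact_neq0 addrC natr1 pnatr_eq0.
Qed.

Lemma pois_le1 x r : 0 <= x -> pois x r <= 1.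
Proof.
move=> x0; rewrite /pois expRN mulrC ler_pdivrMr ?expR_gt0// mul1r.
case: r => [|r]; first by rewrite expr0 fact0 divr1 (le_trans _ (expR_ge1Dx x))// lerDl.
by apply: le_trans (expR_ge1Dxn r x0); rewrite lerDr.
Qed.

(** The two sides agree at [0], and the slope of the left-hand side is
    [2 + ln (1 - y^2)]. *)
Lemma entropy_gap y : 0 <= y < 1 ->
  (1 + y) * ln (1 + y) - (1 - y) * ln (1 - y) <= 2 * y.
Proof.
move=> /andP[y0 y1].
pose f (s : R) := (1 + s) * ln (1 + s) - (1 - s) * ln (1 - s).
have dp z : @is_derive R R R z 1 (fun s : R => 1 + s) 1.
  by apply: (is_derive_eq (is_derive_add (is_derive_const z 1) (is_derive_var z))); rewrite add0r.
have dm z : @is_derive R R R z 1 (fun s : R => 1 - s) (-1).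
  by apply: (is_derive_eq (is_derive_sub (is_derive_const z 1) (is_derive_var z))); rewrite sub0r.
have df z : 0 <= z <= y -> @is_derive R R R z 1 f (2 + ln (1 + z) + ln (1 - z)).
  move=> /andP[z0 zy].
  have p1 : 0 < 1 + z by lra.
  have p2 : 0 < 1 - z by lra.
  have lp := is_derive_mul (dp z)
    (@is_derive_chain R (@ln R) (fun s => 1 + s) z _ _ (is_derive1_ln p1) (dp z)).
  have lm := is_derive_mul (dm z)
    (@is_derive_chain R (@ln R) (fun s => 1 - s) z _ _ (is_derive1_ln p2) (dm z)).
  apply: (is_derive_eq (is_derive_sub lp lm)).
  by field; rewrite !gt_eqF.
have dg z : 0 <= z <= y -> @is_derive R R R z 1 (fun s : R => 2 * s) 2.
  by move=> _; apply: (is_derive_eq (is_derive_scale 2 (is_derive_var z))); rewrite mulr1.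
have := @derive_le_increment R f (fun s => 2 * s) 0 y _ _ y0 df dg.
rewrite /f !subr0 addr0 ln1 !mulr0 !subr0; apply => z /andP[z0 zy].
have p1 : 0 < 1 + z by lra.
have p2 : 0 < 1 - z by lra.
rewrite -addrA gerDl -lnM ?posrE// ln_le0//; nra.
Qed.

(** The worst case [x = r + 1/2] of [pois_sqrt_bound], a quantitative Stirling
    estimate; passing from [r] to [r + 1] is [entropy_gap] at
    [y = 1 / (2 (r + 1))]. *)
Lemma stirling_half r :
  expR (- (r.*2.+1)%:R) * (r%:R + 2^-1) ^+ r.*2.+1 * (2 * expR 1) <= r`!%:R ^+ 2 :> R.
Proof.
elim: r => [|r IH].
  rewrite fact0 double0 add0r expr1 expRN.
  rewrite [leLHS](_ : _ = 1) ?expr1n//.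
  by field; rewrite gt_eqF ?expR_gt0.
set k := r.*2.+1 in IH *.
have kE : k%:R = 2 * r%:R + 1 :> R by rewrite /k -natr1 -muln2 natrM mulrC.
have r0 : 0 <= r%:R :> R by [].
set n := r%:R + 1 : R.
have n0 : 0 < n by rewrite /n; lra.
pose y := (2 * n)^-1.
have y01 : 0 <= y < 1.
  rewrite invr_ge0 invf_lt1 ?mulr_gt0//; rewrite /n in n0 *; apply/andP; split; lra.
have yn : 2 * n * y = 1 by rewrite /y divff// gt_eqF// mulr_gt0.
have step : (r.+1%:R + 2^-1) ^+ k.+2 <= expR 2 * n ^+ 2 * (r%:R + 2^-1) ^+ k.
  have y0 : 0 < y by rewrite invr_gt0 mulr_gt0.
  have ny : n * y = 2^-1 by apply: (@mulfI _ 2) => //; rewrite mulrA yn divff.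
  have e1 : r.+1%:R + 2^-1 = n * (1 + y) by rewrite mulrDr ny mulr1 -natr1.
  have e2 : r%:R + 2^-1 = n * (1 - y) by rewrite mulrBr ny mulr1 /n; lra.
  have [? ?] : 0 < 1 + y /\ 0 < 1 - y by split; lra.
  have lnP a i : 0 < a -> ln ((n * a) ^+ i) = i%:R * ln n + i%:R * ln a.
    by move=> a0; rewrite lnXn ?mulr_gt0// lnM ?posrE// mulrnDl !mulr_natl.
  have k2 : k.+2%:R = 2 * r%:R + 3 :> R by rewrite -2!natr1 kE; lra.
  have nk a i : 0 < a -> 0 < (n * a) ^+ i by move=> a0; rewrite exprn_gt0 ?mulr_gt0.
  rewrite e1 e2 -ler_ln ?posrE ?nk ?mulr_gt0 ?expR_gt0 ?exprn_gt0 ?nk//.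
  rewrite lnP// [leRHS]lnM ?posrE ?nk ?mulr_gt0 ?expR_gt0 ?exprn_gt0//.
  rewrite lnP// [ln (expR 2 * _)]lnM ?posrE ?expR_gt0 ?exprn_gt0//.
  rewrite expRK lnXn// -[ln n *+ 2]mulr_natl kE k2.
  have := entropy_gap y01; set lp := ln (1 + y); set lm := ln (1 - y) => h.
  have {}h : 2 * n * ((1 + y) * lp - (1 - y) * lm) <= 2 * n * (2 * y).
    by rewrite ler_wpM2l// mulr_ge0// ltW.
  have h1 : 2 * n * ((1 + y) * lp) = (2 * r%:R + 3) * lp.
    by rewrite mulrA mulrDr yn mulr1 /n; congr (_ * _); lra.
  have h2 : 2 * n * ((1 - y) * lm) = (2 * r%:R + 1) * lm.
    by rewrite mulrA mulrBr yn mulr1 /n; congr (_ * _); lra.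
  rewrite [in X in X <= _]mulrBr h1 h2 in h.
  have h3 : 2 * n * (2 * y) = 2 by rewrite mulrCA yn mulr1.
  rewrite h3 in h.
    by set ln_n := ln n; lra.
  by rewrite mulr_gt0.
rewrite doubleS factS natrM exprMn -[r.+1%:R in leRHS]natr1 -/n -/k.
apply: le_trans (_ : n ^+ 2 * (expR (- k%:R) * (r%:R + 2^-1) ^+ k * (2 * expR 1)) <= _); last first.
  by rewrite ler_wpM2l// exprn_ge0// ltW.
rewrite [leRHS]mulrA ler_wpM2r ?mulr_ge0 ?expR_ge0//.
have -> : expR (- k.+2%:R) = expR (- k%:R) * (expR 2)^-1 :> R.
  by rewrite -expRN -expRD; congr expR; rewrite -2!natr1; lra.
rewrite [leRHS]mulrCA -mulrA ler_wpM2l ?expR_ge0//.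
by rewrite ler_pdivrMl ?expR_gt0// mulrA.
Qed.

(** The Poisson mass at a given point, weighted by the square root of the mean,
    is largest when the mean is half a unit above the point; this reduces to
    [stirling_half] by [t <= expR (t - 1)], which is tight there. *)
Lemma pois_sqrt_bound x r : 0 <= x -> pois x r ^+ 2 * (2 * expR 1 * x) <= 1.
Proof.
move=> x0; set k := r.*2.+1; set v := r%:R + 2^-1 : R.
have kE : k%:R = 2 * v by rewrite /k /v -natr1 -muln2 natrM; lra.
have v0 : 0 < v by rewrite /v ltr_wpDl// invr_gt0.
have h : x ^+ k <= v ^+ k * expR (2 * x - k%:R).
  rewrite -ler_pdivrMl ?exprn_gt0// -exprVn -exprMn.
  have -> : 2 * x - k%:R = (v^-1 * x - 1) * k%:R by rewrite kE; field; rewrite gt_eqF.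
  rewrite expRM_natr lerXn2r ?nnegrE ?expR_ge0 ?mulr_ge0 ?invr_ge0 ?(ltW v0)//.
  by have := expR_ge1Dx (v^-1 * x - 1); rewrite addrC subrK.
have -> : pois x r ^+ 2 * (2 * expR 1 * x) =
    (r`!%:R ^+ 2)^-1 * (expR (- (2 * x)) * x ^+ k * (2 * expR 1)).
  have -> : expR (- (2 * x)) = expR (- x) ^+ 2.
    by rewrite -expRM_natl; congr expR; lra.
  rewrite /k [x ^+ r.*2.+1]exprS -muln2 exprM /pois; field; exact: fact_neq0.
rewrite ler_pdivrMl ?exprn_gt0 ?ltr0n ?fact_gt0// mulr1.
apply: le_trans (stirling_half r); rewrite -/k -/v.
rewrite ler_wpM2r ?mulr_ge0 ?expR_ge0//.
apply: le_trans (ler_wpM2l (expR_ge0 _) h) _.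
rewrite mulrCA -expRD mulrC (_ : - (2 * x) + _ = - k%:R)//; ring.
Qed.

End PoissonMode.

(** * Shortfall and excess of a Poisson variable *)

Section PoissonSums.
Context {R : realType}.
Implicit Types (x : R) (i n : nat).

Definition pois_cdf x i : R := \sum_(j < i.+1) pois x j.

(** The mean shortfall [E (n - N)^+] and mean excess [E (N - n)^+] of a Poisson
    variable [N] of mean [x]; the second is the first plus [E N - n]. *)
Definition shortfall x n : R := \sum_(j < n) (n%:R - j%:R) * pois x j.
Definition excess x n : R := shortfall x n + x - n%:R.

Lemma pois_cdfS x i : pois_cdf x i.+1 = pois_cdf x i + pois x i.+1.
Proof. by rewrite /pois_cdf big_ord_recr. Qed.

Lemma pois_cdf_gt0 x i : 0 < x -> 0 < pois_cdf x i.
Proof.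
move=> x0; rewrite /pois_cdf big_ord_recl /= ltr_pwDl ?pois_gt0//.
by apply: sumr_ge0 => j _; rewrite pois_ge0 ?ltW.
Qed.

Lemma shortfall_ge0 x n : 0 <= x -> 0 <= shortfall x n.
Proof.
move=> x0; apply: sumr_ge0 => j _; rewrite mulr_ge0 ?pois_ge0//.
by rewrite subr_ge0 ler_nat ltnW.
Qed.

(** The mean of [N] over [N <= n + 1] is [x * P(N <= n)], by [poisS]. *)
Lemma shortfallE x n :
  shortfall x n.+1 = n.+1%:R * pois_cdf x n.+1 - x * pois_cdf x n.
Proof.
have mean k : \sum_(j < k.+2) j%:R * pois x j = x * pois_cdf x k.
  rewrite big_ord_recl /= mul0r add0r /pois_cdf mulr_sumr.
  by apply: eq_bigr => j _; rewrite poisS.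
rewrite -mean /pois_cdf mulr_sumr -sumrB [RHS]big_ord_recr /= subrr addr0.
by apply: eq_bigr => j _; rewrite mulrBl.
Qed.

End PoissonSums.

(** * The immigration-death process *)

Section ImmigrationDeath.
Context {R : realType}.
Variables (lam : R) (n : nat).
Hypothesis lam_gt0 : 0 < lam.
Implicit Types (g h : nat -> R) (s c : R) (m k : nat).

(** [imm m g s] is [E g(W)] for [W] the sum of independent variables
    Poisson([lam * s]) and Binomial([m], [1 - s]): the state, at time
    [- ln (1 - s)], of the immigration-death process started from [m].
    Truncating the Poisson sum at [n] loses nothing for [g] supported
    below [n]. *)
Fixpoint imm m g s : R :=
  if m is m'.+1 then (1 - s) * imm m' (fun k => g k.+1) s + s * imm m' g s
  else \sum_(r < n) g r * pois (lam * s) r.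

Lemma immS m g s :
  imm m.+1 g s = (1 - s) * imm m (fun k => g k.+1) s + s * imm m g s.
Proof. by []. Qed.

Lemma immB m g h s : imm m (fun k => g k - h k) s = imm m g s - imm m h s.
Proof.
elim: m g h => [|m IH] g h /=; last by rewrite !IH; ring.
by rewrite -sumrB; apply: eq_bigr => r _; rewrite mulrBl.
Qed.

Lemma eq_imm m g h s : g =1 h -> imm m g s = imm m h s.
Proof. by move=> /funext ->. Qed.

Lemma imm0 m g : (forall k, (n <= k)%N -> g k = 0) -> imm m g 0 = g m.
Proof.
elim: m g => [|m IH] g g0 /=.
  rewrite mulr0; case: n g0 => [|n'] g0; first by rewrite big_ord0 g0.
  rewrite big_ord_recl /= big1 => [|r _].
    by rewrite /pois oppr0 expR0 expr0 fact0 divr1 !mulr1 addr0.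
  by rewrite /pois exprS !(mul0r, mulr0).
rewrite subr0 mul1r mul0r addr0 IH// => k nk.
by rewrite g0// (leq_trans nk).
Qed.

Lemma imm1 m g : imm m g 1 = \sum_(r < n) g r * pois lam r.
Proof.
elim: m g => [|m IH] g /=; first by rewrite mulr1.
by rewrite subrr mul0r add0r mul1r.
Qed.

(** Conditionally on the binomial summand, only a shifted [g] of the Poisson one
    remains. *)
Lemma imm_le m g s c : 0 <= s <= 1 ->
  (forall j, \sum_(r < n) g (r + j)%N * pois (lam * s) r <= c) -> imm m g s <= c.
Proof.
move=> /andP[s0 s1]; elim: m g => [|m IH] g gc /=.
  by apply: le_trans (gc 0%N); apply: ler_sum => r _; rewrite addn0.
rewrite (_ : c = (1 - s) * c + s * c); last by ring.
rewrite lerD// ler_wpM2l ?subr_ge0// IH// => j.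
by apply: le_trans (gc j.+1); apply: ler_sum => r _; rewrite addnS.
Qed.

(** The Kolmogorov equation of the process, in the time variable [s]. *)
Lemma is_derive_imm m g s : (forall k, (n <= k)%N -> g k = 0) ->
  is_derive s 1 (imm m g)
    (lam * imm m (fun k => g k.+1 - g k) s
     - m%:R * imm m.-1 (fun k => g k.+1 - g k) s).
Proof.
elim: m g => [|m IH] g g0.
  rewrite mul0r subr0 /=.
  have dlin : @is_derive R R R s 1 (fun s => lam * s) lam.
    by apply: (is_derive_eq (is_derive_scale lam (is_derive_var s))); rewrite mulr1.
  have sum0 k : @is_derive R R R s 1 (fun s => \sum_(r < k) g r * pois (lam * s) r)
    (lam * (\sum_(r < k) (g r.+1 - g r) * pois (lam * s) r
            - (if k is k'.+1 then g k * pois (lam * s) k' else 0))).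
    elim: k => [|k IHk].
      under eq_fun do rewrite big_ord0.
      by apply: (is_derive_eq (is_derive_const s 0)); rewrite big_ord0 subrr mulr0.
    under eq_fun do rewrite big_ord_recr /=.
    case: k IHk => [|k] IHk.
      have d0 := @is_derive_chain R _ _ s _ _ (is_derive_pois0 (lam * s)) dlin.
      apply: (is_derive_eq (is_derive_add IHk (is_derive_scale (g 0%N) d0))).
      by rewrite big_ord_recr !big_ord0 /=; ring.
    have d1 := @is_derive_chain R _ _ s _ _ (is_derive_poisS (lam * s) k) dlin.
    apply: (is_derive_eq (is_derive_add IHk (is_derive_scale (g k.+1) d1))).
    by rewrite [in RHS]big_ord_recr /=; ring.
  apply: (is_derive_eq (sum0 n)).
  by case: n g0 => [|n'] g0; rewrite ?g0// ?mul0r subr0.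
have gS k : (n <= k)%N -> g k.+1 = 0 by move=> nk; rewrite g0// (leq_trans nk).
have d1s : @is_derive R R R s 1 (fun s => 1 - s) (-1).
  by apply: (is_derive_eq (is_derive_sub (is_derive_const s 1) (is_derive_var s))); rewrite sub0r.
apply: (is_derive_eq (is_derive_add (is_derive_mul d1s (IH _ gS))
  (is_derive_mul (is_derive_var s) (IH _ g0)))).
rewrite [m.+1.-1]/=; case: m {IH} => [|m]; rewrite immS !immB; first by ring.
by rewrite [m.+1.-1]/= !immS -[m.+2%:R]natr1; ring.
Qed.

(** An antiderivative in [s] of the probability that the process started from
    [m] is below [n]. The Kolmogorov equation for [g k = (n - k)^+], whose
    increments are [- (k < n)], determines it from the one for [m - 1]. *)
Fixpoint occupation m s : R :=
  ((if m is m'.+1 then m%:R * occupation m' s else 0)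
   - imm m (fun k => (n - k)%:R) s) / lam.

Lemma occupation0 s :
  occupation 0 s = (0 - imm 0 (fun k => (n - k)%:R) s) / lam.
Proof. by []. Qed.

Lemma occupationS m s : occupation m.+1 s =
  (m.+1%:R * occupation m s - imm m.+1 (fun k => (n - k)%:R) s) / lam.
Proof. by []. Qed.

Lemma is_derive_occupation m s :
  is_derive s 1 (occupation m) (imm m (fun k => (k < n)%:R) s).
Proof.
have supp k : (n <= k)%N -> (n - k)%:R = 0 :> R.
  by rewrite -subn_eq0 => /eqP ->.
have slope j : imm j (fun k => (n - k.+1)%:R - (n - k)%:R) s
             = - imm j (fun k => (k < n)%:R) s.
  rewrite -sub0r -[X in X - _](subrr (imm j (fun k => (k < n)%:R) s)).
  rewrite -!immB; apply: eq_imm => k; rewrite subrr sub0r.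
  case: ltnP => kn; first by rewrite !natrB ?(ltnW kn)// -[k.+1%:R]natr1 mulr1n; ring.
  by rewrite !supp ?subrr ?oppr0// (leq_trans kn).
elim: m => [|m IH].
  apply: (is_derive_eq (is_derive_mul (is_derive_sub (is_derive_const s 0)
     (is_derive_imm 0 s supp)) (is_derive_const s lam^-1))).
  by rewrite !slope; field; rewrite gt_eqF.
apply: (is_derive_eq (is_derive_mul (is_derive_sub (is_derive_scale m.+1%:R IH)
     (is_derive_imm m.+1 s supp)) (is_derive_const s lam^-1))).
by rewrite !slope [m.+1.-1]/=; field; rewrite gt_eqF.
Qed.

(** The increments satisfy a first-order recurrence in [m], which is solved by
    the right-hand side. *)
Lemma occupation_increment m : (m <= n)%N ->
  occupation m 1 - occupation m 0 =
  1 - excess lam n * (pois_cdf lam m / (lam * pois lam m)).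
Proof.
have supp k : (n <= k)%N -> (n - k)%:R = 0 :> R.
  by rewrite -subn_eq0 => /eqP ->.
have sf : shortfall lam n = \sum_(r < n) (n - r)%:R * pois lam r.
  by apply: eq_bigr => r _; rewrite natrB// ltnW.
have lam_neq0 : lam != 0 by rewrite gt_eqF.
have p0 j : pois lam j != 0 by rewrite gt_eqF ?pois_gt0.
elim: m => [_|m IH mn].
  rewrite !occupation0 -mulrBl imm1 (imm0 0 supp) -sf subn0 /excess.
  rewrite /pois_cdf big_ord_recr big_ord0 /= add0r.
  by field; rewrite p0.
rewrite !occupationS -mulrBl imm1 (imm0 m.+1 supp) -sf natrB// /excess pois_cdfS.
have {IH} := IH (ltnW mn); rewrite /excess => /(canRL (subrK _)) ->.
have m0 : m.+1%:R != 0 :> R by rewrite pnatr_eq0.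
have -> : pois lam m.+1 = lam * pois lam m / m.+1%:R.
  by rewrite -poisS mulrC mulKf.
field; rewrite p0 lam_neq0 /=.
by rewrite addrC natr1 pnatr_eq0.
Qed.

End ImmigrationDeath.

(** * The product of shortfall and excess *)

Section SteinFactor.
Context {R : realType}.
Variables (lam : R) (i : nat).
Hypothesis lam_gt0 : 0 < lam.
Implicit Types (s : R).

(* Started from [i + 1] instead of [i], the process has one more individual,
   alive with probability [1 - s]; it decides whether the state is below [i + 1]
   exactly when the others are in number [i]. Hence [F] has derivative
   [(1 - s) * mass s]. *)
Let mass s := imm lam i.+1 i (fun k => (k == i)%:R) s.
Let F s := occupation lam i.+1 i s - occupation lam i.+1 i.+1 s.

Let is_derive_F s : is_derive s 1 F ((1 - s) * mass s).
Proof.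
apply: (is_derive_eq (is_derive_sub (is_derive_occupation i.+1 lam_gt0 i s)
                                    (is_derive_occupation i.+1 lam_gt0 i.+1 s))).
have -> : mass s = imm lam i.+1 i (fun k => (k < i.+1)%:R) s
                   - imm lam i.+1 i (fun k => (k.+1 < i.+1)%:R) s.
  rewrite -immB; apply: eq_imm => k.
  by rewrite !ltnS; case: ltngtP; rewrite ?subrr ?subr0.
by rewrite immS; ring.
Qed.

Let F_increment : F 1 - F 0 =
  shortfall lam i.+1 * excess lam i.+1 / (lam * i.+1%:R * pois lam i.+1).
Proof.
have := occupation_increment lam_gt0 (leqnSn i).
have := occupation_increment lam_gt0 (leqnn i.+1).
move=> /(canRL (subrK _)) e1 /(canRL (subrK _)) e0.
rewrite /F e0 e1 shortfallE pois_cdfS.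
have m0 : i.+1%:R != 0 :> R by rewrite pnatr_eq0.
have -> : pois lam i.+1 = lam * pois lam i / i.+1%:R.
  by rewrite -poisS mulrC mulKf.
have p0 : pois lam i != 0 by rewrite gt_eqF ?pois_gt0.
have l0 : lam != 0 by rewrite gt_eqF.
by field; rewrite p0 l0 /= addrC natr1 pnatr_eq0.
Qed.

(* Each shift of the point mass at [i] picks at most one Poisson weight. *)
Let mass_le c s : 0 <= s <= 1 -> 0 <= c -> (forall r, pois (lam * s) r <= c) ->
  mass s <= c.
Proof.
move=> s01 c0 pc; apply: imm_le => // j.
have sub r : (r + j == i)%N = (j <= i)%N && (r == i - j)%N by lia.
under eq_bigr do rewrite sub.
case: (leqP j i) => ji /=; last by rewrite big1 // => r _; rewrite mul0r.
have ji' : (i - j < i.+1)%N by rewrite ltnS leq_subr.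
rewrite (bigD1 (Ordinal ji'))//= eqxx mul1r big1 ?addr0// => r rn.
have /negPf -> : nat_of_ord r != (i - j)%N.
  by apply: contraNneq rn => ri; apply/eqP/val_inj.
by rewrite mul0r.
Qed.

(** The mass is at most [1], and [1 - s] has integral [1 / 2]. *)
Lemma shortfall_excess_le1 :
  2 * (shortfall lam i.+1 * excess lam i.+1) <= lam * i.+1%:R * pois lam i.+1.
Proof.
have q0 : 0 < lam * i.+1%:R * pois lam i.+1 by rewrite mulr_gt0 ?pois_gt0 ?mulr_gt0.
pose g (s : R) := s - 2^-1 * s ^+ 2.
have dg s : @is_derive R R R s 1 g (1 - s).
  apply: (is_derive_eq (is_derive_sub (is_derive_var s)
           (is_derive_scale 2^-1 (is_derive_monom s 2)))).
  by rewrite /=; field.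
have : F 1 - F 0 <= g 1 - g 0.
  apply: (derive_le_increment ler01 (fun s _ => is_derive_F s) (fun s _ => dg s)).
  move=> s /andP[s0 s1]; rewrite ler_piMr ?subr_ge0 ?(ltW s1)//.
  apply: mass_le => // [|r]; first by rewrite !ltW.
  by rewrite pois_le1// mulr_ge0 ?ltW.
rewrite F_increment ler_pdivrMr// /g expr0n expr1n /=.
set a := shortfall _ _ * _; lra.
Qed.

(** Bounding the mass at time [s] by [1 / sqrt (2 e lam s)] leaves, up to
    a constant, the Beta integral of [(1 - s) / sqrt s], of value [4/3]; the
    substitution [s = u^2] turns the singular integrand into a polynomial. *)
Lemma shortfall_excess_sqrt :
  3 * Num.sqrt (2 * expR 1 * lam) * (shortfall lam i.+1 * excess lam i.+1) <=
  4 * (lam * i.+1%:R * pois lam i.+1).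
Proof.
have q0 : 0 < lam * i.+1%:R * pois lam i.+1 by rewrite mulr_gt0 ?pois_gt0 ?mulr_gt0.
set kappa := Num.sqrt _.
have e0 : 0 < 2 * expR 1 * lam by rewrite !mulr_gt0 ?expR_gt0.
have k0 : 0 < kappa by rewrite sqrtr_gt0.
pose f (u : R) := kappa * F (u ^+ 2).
pose g (u : R) := 2 * u - 2 / 3 * u ^+ 3.
have df u : @is_derive R R R u 1 f (kappa * (2 * u * ((1 - u ^+ 2) * mass (u ^+ 2)))).
  apply: is_derive_scale.
  apply: (is_derive_eq (@is_derive_chain R F (fun u => u ^+ 2) u _ _
    (is_derive_F _) (is_derive_monom u 2))).
  by [].
have dg u : @is_derive R R R u 1 g (2 * (1 - u ^+ 2)).
  apply: (is_derive_eq (is_derive_sub (is_derive_scale 2 (is_derive_var u))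
           (is_derive_scale (2 / 3) (is_derive_monom u 3)))).
  by rewrite /=; field.
have : f 1 - f 0 <= g 1 - g 0.
  apply: (derive_le_increment ler01 (fun u _ => df u) (fun u _ => dg u)).
  move=> u /andP[u0 u1].
  have u2 : u ^+ 2 <= 1 by rewrite expr_le1// ltW.
  have -> : kappa * (2 * u * ((1 - u ^+ 2) * mass (u ^+ 2))) =
            2 * (1 - u ^+ 2) * (kappa * u * mass (u ^+ 2)) by ring.
  rewrite ler_piMr ?mulr_ge0 ?subr_ge0// mulrC -ler_pdivlMr ?mulr_gt0// div1r.
  apply: mass_le => [|//|r].
  - by rewrite u2 sqr_ge0.
  - by rewrite invr_ge0 mulr_ge0 ?ltW.
  have p0 : 0 <= lam * u ^+ 2 by rewrite mulr_ge0 ?sqr_ge0 ?ltW.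
  have := pois_sqrt_bound r p0; set p := pois _ _ => pb.
  rewrite -[leRHS]div1r ler_pdivlMr ?mulr_gt0// -(@expr_le1 _ 2)//.
    have -> : (p * (kappa * u)) ^+ 2 = p ^+ 2 * (kappa ^+ 2 * u ^+ 2) by ring.
    by rewrite sqr_sqrtr ?(ltW e0)// -[2 * _ * lam * _]mulrA.
  by rewrite mulr_ge0 ?pois_ge0 ?mulr_ge0 ?ltW.
rewrite /f expr1n expr0n /= -mulrBr F_increment.
set a := shortfall _ _ * _; set q := lam * _ * _ in q0 *.
rewrite [kappa * _]mulrA ler_pdivrMr// /g expr1n expr0n /=.
have -> : 2 * 1 - 2 / 3 * 1 - (2 * 0 - 2 / 3 * 0) = 4 / 3 :> R by field.
lra.
Qed.

End SteinFactor.

(** * Solution of the Stein equation *)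

(** The first eight terms of the exponential series. *)
Lemma expR1_ge (R : realType) : 685 / 252 <= expR 1 :> R.
Proof.
have := @nondecreasing_cvgn_le R (series (exp_coeff 1)).
move=> /(_ _ (is_cvg_series_exp_coeff 1) 8%N) h.
have {h} : series (exp_coeff (1 : R)) 8 <= expR 1.
  by apply: h; apply/nondecreasing_seqP => n; rewrite -subr_ge0 seriesSB divr_ge0 ?exprn_ge0.
apply: le_trans; rewrite /series /= /exp_coeff !big_nat_recl// big_geq//=.
rewrite !expr1n !factS fact0 !natrM; lra.
Qed.

Section SteinEquation.
Context {R : realType}.
Variable lam : R.
Hypothesis lam_gt0 : 0 < lam.
Implicit Types (g f : nat -> R) (mu c : R) (i n v x y : nat).

Let lam_neq0 : lam != 0. Proof. by rewrite gt_eqF. Qed.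
Let p_gt0 i : 0 < pois lam i. Proof. exact: pois_gt0. Qed.
Let p_neq0 i : pois lam i != 0. Proof. by rewrite gt_eqF. Qed.
Let S_neq0 n : n.+1%:R != 0 :> R. Proof. by rewrite pnatr_eq0. Qed.

(** The value at [i] is the one usually attached to [i + 1], so that all values
    are determined by the equation, in the form [steinE]. *)
Definition stein g mu i : R :=
  (\sum_(j < i.+1) pois lam j * (g j - mu)) / (lam * pois lam i).

Lemma steinE g mu i :
  lam * stein g mu i - i%:R * stein g mu i.-1 = g i - mu.
Proof.
case: i => [|i] /=.
  rewrite /stein big_ord_recr big_ord0 /=.
  by field; rewrite p_neq0 lam_neq0.
rewrite /stein big_ord_recr /=; set s := \sum_(_ < _) _.
have -> : pois lam i.+1 = lam * pois lam i / i.+1%:R by rewrite -poisS mulrC mulKf.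
by field; rewrite p_neq0 lam_neq0 addrC natr1 S_neq0.
Qed.

(** For [mu = E g(N)], these are the contributions of [N < n] and of [N > n] to
    the expectation of [g(N) - g(n)]. *)
Definition head_part g n : R := \sum_(j < n) pois lam j * (g j - g n).
Definition tail_part g mu n : R := mu - g n - head_part g n.

Lemma sum_head g mu n : \sum_(j < n.+1) pois lam j * (g j - mu) =
  head_part g n * (1 - pois_cdf lam n) - tail_part g mu n * pois_cdf lam n.
Proof.
have -> : \sum_(j < n.+1) pois lam j * (g j - mu) =
          head_part g n + pois_cdf lam n * (g n - mu).
  have -> : head_part g n = \sum_(j < n.+1) pois lam j * (g j - g n).
    by rewrite [RHS]big_ord_recr /= subrr mulr0 addr0.
  rewrite /pois_cdf mulr_suml -big_split /=.
  by apply: eq_bigr => j _; ring.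
by rewrite /tail_part; ring.
Qed.

(** The value [g i.+1] has no weight of its own, since constants have solution
    [0]. The weights of the two parts come from
    [lam * P(N > i) - i.+1 * P(N > i.+1) = excess] and
    [i.+1 * P(N <= i.+1) - lam * P(N <= i) = shortfall]. *)
Lemma stein_increment g mu i : stein g mu i.+1 - stein g mu i =
  - (head_part g i.+1 * excess lam i.+1 + tail_part g mu i.+1 * shortfall lam i.+1)
  / (lam * i.+1%:R * pois lam i.+1).
Proof.
have s1 := sum_head g mu i.+1.
have := s1; rewrite big_ord_recr /= => /(canRL (addrK _)) s0.
rewrite /stein s1 s0 /excess shortfallE pois_cdfS.
have gmu : g i.+1 - mu = - (head_part g i.+1 + tail_part g mu i.+1).
  by rewrite /tail_part; ring.
rewrite gmu.
have -> : pois lam i.+1 = lam * pois lam i / i.+1%:R by rewrite -poisS mulrC mulKf.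
by field; rewrite p_neq0 lam_neq0 addrC natr1 S_neq0.
Qed.

(** The extremal case is [g j = j], whose solution is the constant [-1]. *)
Lemma stein_le1 g mu i :
  `|head_part g i| <= shortfall lam i -> `|tail_part g mu i| <= excess lam i ->
  pois_cdf lam i <= 1 -> `|stein g mu i| <= 1.
Proof.
move=> hS hH F1.
have F0 : 0 <= pois_cdf lam i by rewrite ltW// pois_cdf_gt0.
have q0 : 0 < lam * pois lam i by rewrite mulr_gt0.
rewrite /stein sum_head normrM normfV [`|lam * _|]gtr0_norm// ler_pdivrMr// mul1r.
have key : shortfall lam i * (1 - pois_cdf lam i) + excess lam i * pois_cdf lam i
           = lam * pois lam i.
  rewrite /excess; case: (i) => [|k].
    by rewrite /shortfall /pois_cdf big_ord0 big_ord_recr big_ord0 /=; ring.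
  by rewrite shortfallE pois_cdfS; ring.
rewrite -key (le_trans (ler_normB _ _))// !normrM.
rewrite [`|1 - _|]ger0_norm ?subr_ge0// [`|pois_cdf _ _|]ger0_norm//.
by rewrite lerD// ler_wpM2r// subr_ge0.
Qed.

Lemma stein_slope g mu i a b :
  `|head_part g i.+1| <= a -> `|tail_part g mu i.+1| <= b ->
  0 <= excess lam i.+1 ->
  `|stein g mu i.+1 - stein g mu i| <=
    (a * excess lam i.+1 + b * shortfall lam i.+1)
    / (lam * i.+1%:R * pois lam i.+1).
Proof.
move=> hS hH b0.
have a0 := shortfall_ge0 i.+1 (ltW lam_gt0).
have q0 : 0 < lam * i.+1%:R * pois lam i.+1 by rewrite mulr_gt0 ?pois_gt0 ?mulr_gt0.
rewrite stein_increment normrM normfV [`|lam * _ * _|]gtr0_norm// ler_wpM2r ?invr_ge0 ?(ltW q0)//.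
rewrite normrN (le_trans (ler_normD _ _))// !normrM.
by rewrite (ger0_norm a0) (ger0_norm b0) lerD// ler_wpM2r.
Qed.

(** The worst case, where both parts reach their bounds with the same sign, is
    twice the product estimated above. *)
Lemma stein_slope_Lip1 g mu i :
  `|head_part g i.+1| <= shortfall lam i.+1 ->
  `|tail_part g mu i.+1| <= excess lam i.+1 ->
  lam * `|stein g mu i.+1 - stein g mu i| <=
    Num.min (11437 / 10000 * Num.sqrt lam) lam.
Proof.
move=> hS hH; have b0 : 0 <= excess lam i.+1 by apply: le_trans hH.
have := stein_slope hS hH b0; set D := `|_|.
have q0 : 0 < lam * i.+1%:R * pois lam i.+1 by rewrite mulr_gt0 ?pois_gt0 ?mulr_gt0.
have := shortfall_excess_le1 i lam_gt0; have := shortfall_excess_sqrt i lam_gt0.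
rewrite ler_pdivlMr// [excess _ _ * _]mulrC.
set ab := _ * excess _ _; set q := lam * _ * _ in q0 *; set kappa := Num.sqrt _.
move=> h2 h1 hD; rewrite le_min; apply/andP; split; last first.
  rewrite -[leRHS]mulr1 ler_wpM2l ?(ltW lam_gt0)//; nra.
have k0 : 0 < kappa by rewrite sqrtr_gt0 mulr_gt0 ?mulr_gt0 ?expR_gt0.
have kD : kappa * D <= 8 / 3.
  rewrite -(ler_pM2r q0); have : kappa * (D * q) <= kappa * (ab + ab).
    by rewrite ler_wpM2l// ltW.
  lra.
set t := Num.sqrt lam; set w : R := Num.sqrt (2 * expR 1).
have tt : t * t = lam by rewrite -expr2 sqr_sqrtr// ltW.
have t0 : 0 < t by rewrite sqrtr_gt0.
have kE : kappa = w * t by rewrite /kappa sqrtrM ?mulr_ge0 ?expR_ge0.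
have w0 : 0 < w by rewrite sqrtr_gt0 mulr_gt0 ?expR_gt0.
(* The numerical content is [(8 / 3 / 1.1437)^2 <= 2 * expR 1]; the fraction
   [390 / 341] lies just below [1.1437]. *)
have wb : 8 / 3 <= 11437 / 10000 * w.
  apply: (@le_trans _ _ (390 / 341 * w)); last first.
    have : 390 / 341 <= 11437 / 10000 :> R by lra.
    by move=> h; rewrite ler_wpM2r// ltW.
  have n1 : (8 / 3 : R) \is Num.nneg by rewrite nnegrE.
  have n2 : 390 / 341 * w \is Num.nneg by rewrite nnegrE; apply: mulr_ge0; [lra|exact: ltW].
  rewrite -(@ler_pXn2r R 2 isT _ _ n1 n2).
  rewrite [leRHS]exprMn [w ^+ 2]sqr_sqrtr ?mulr_ge0 ?expR_ge0//.
  by have := expR1_ge R; lra.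
have D0 : 0 <= D by rewrite normr_ge0.
have tD : t * D <= 11437 / 10000.
  by rewrite -(ler_pM2l w0) mulrA -kE (le_trans kD)// [leRHS]mulrC.
have -> : lam * D = t * (t * D) by rewrite mulrA tt.
by rewrite [leRHS]mulrC; apply: ler_wpM2l => //; exact: ltW.
Qed.

Lemma Lipschitz_from_slopes f c x y : (forall i, `|f i.+1 - f i| <= c) ->
  `|f x - f y| <= c * `|x%:R - y%:R|.
Proof.
move=> fc; wlog xy : x y / (x <= y)%N.
  by move=> H; case: (leqP x y) => [/H//|/ltnW /H]; rewrite distrC [`|y%:R - _|]distrC.
rewrite distrC [`|x%:R - _|]distrC -natrB// [`|_%:R|]ger0_norm//.
rewrite -telescope_sumr// (le_trans (ler_norm_sum _ _ _))//.
rewrite (le_trans (ler_sum _ (fun i _ => fc i)))//.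
by rewrite sumr_const_nat mulr_natr.
Qed.

(** The two error terms of the slope recombine: since
    [lam * cdf i <= i.+1 * cdf i.+1], they sum to at most [1 / lam]. *)
Lemma stein_slope_indic g mu i :
  `|head_part g i.+1| <= pois_cdf lam i ->
  `|tail_part g mu i.+1| <= 1 - pois_cdf lam i.+1 ->
  0 <= excess lam i.+1 ->
  lam * `|stein g mu i.+1 - stein g mu i| <= 1.
Proof.
move=> hS hH b0; have := stein_slope hS hH b0; set D := `|_|.
have := shortfall_ge0 i.+1 (ltW lam_gt0).
rewrite /excess shortfallE pois_cdfS.
have q0 : 0 < i.+1%:R * pois lam i.+1 by rewrite mulr_gt0.
have q1 : 0 < lam * i.+1%:R * pois lam i.+1 by rewrite mulr_gt0 ?pois_gt0 ?mulr_gt0.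
have p0 := p_gt0 i.+1.
rewrite ler_pdivlMr//.
set F := pois_cdf _ _; set p := pois lam _ in q0 p0 *; set n := i.+1%:R in q0 *.
move=> a0 hD.
rewrite -(ler_pM2r q0) mul1r.
apply: (@le_trans _ _ (p * (lam * F + n * (1 - (F + p))))).
  rewrite [leLHS](_ : _ = D * (lam * n * p)); last by ring.
  by rewrite (le_trans hD)// [leLHS](_ : _ = p * (lam * F + n * (1 - (F + p))))//; ring.
by rewrite mulrC ler_pM2r//; lra.
Qed.

End SteinEquation.

(** * The Stein solution for the indicator of an initial segment *)

Section StepFunction.
Context {R : realType}.
Variables (lam : R) (v : nat).
Hypothesis lam_gt0 : 0 < lam.
Hypothesis excess_ge0 : forall n, 0 <= excess lam n.
Hypothesis cdf_le1 : forall n, pois_cdf lam n <= 1.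
Implicit Types (i x y : nat).

Let p_gt0 i : 0 < pois lam i. Proof. exact: pois_gt0. Qed.

Let f : nat -> R := stein lam (fun k => (k <= v)%:R) (pois_cdf lam v).

Lemma stein_stepE i : (v <= i)%N ->
  lam * f i = pois_cdf lam v * (1 - pois_cdf lam i) / pois lam i.
Proof.
move=> vi; rewrite /f /stein.
have -> : \sum_(j < i.+1) pois lam j * ((j <= v)%:R - pois_cdf lam v) =
    pois_cdf lam v * (1 - pois_cdf lam i).
  under eq_bigr do rewrite mulrBr.
  rewrite sumrB -mulr_suml -/(pois_cdf lam i) mulrBr mulr1 mulrC; congr (_ - _).
  rewrite /pois_cdf (@big_ord_widen _ _ _ v.+1 i.+1 (fun j => pois lam j))// [RHS]big_mkcond.
  by apply: eq_bigr => j _; rewrite ltnS; case: leqP; rewrite ?mulr1 ?mulr0.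
by field; rewrite !gt_eqF.
Qed.

Lemma stein_step_ge0 i : (v <= i)%N -> 0 <= lam * f i.
Proof.
move=> vi; rewrite stein_stepE// divr_ge0 ?(ltW (p_gt0 i))// mulr_ge0 ?subr_ge0//.
by rewrite ltW// pois_cdf_gt0.
Qed.

(** By [stein_stepE], this is [m.+1 * P(N > m.+1) <= lam * P(N > m)], that is,
    nonnegativity of the excess over [m.+1]. *)
Lemma stein_step_decr i j : (v <= i)%N -> (i <= j)%N -> lam * f j <= lam * f i.
Proof.
move=> vi /subnK <-; elim: (j - i)%N => [|k IH]; first by rewrite add0n.
apply: le_trans IH; rewrite addSn !stein_stepE; try lia.
set m := (k + i)%N; rewrite -!mulrA ler_wpM2l ?(ltW (pois_cdf_gt0 _ _))//.
rewrite ler_pdivrMr// mulrAC ler_pdivlMr//.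
have := excess_ge0 m.+1; rewrite /excess shortfallE => b0.
have n0 : 0 < m.+1%:R :> R by [].
rewrite -(ler_pM2l n0) [leRHS]mulrCA poisS.
have := p_gt0 m; set F := pois_cdf _ _ in b0 *; set F' := pois_cdf _ _ in b0 *.
set p := pois _ _; set n := m.+1%:R in b0 *; nra.
Qed.

(** The difference of two values of a nonnegative nonincreasing function is at
    most the one on the left, and [`|x - y| >= 1] unless [x = y]. *)
Lemma stein_step_diff x y : (v <= minn x y)%N ->
  lam * `|f x - f y| <= lam * f (minn x y) * `|x%:R - y%:R|.
Proof.
wlog xy : x y / (x <= y)%N.
  move=> H hv; case/orP: (leq_total x y) => [xy|yx]; first exact: H.
  by rewrite distrC [`|x%:R - _|]distrC minnC; apply: H; rewrite // minnC.
rewrite (minn_idPl xy) => vx; move: xy; rewrite leq_eqVlt => /predU1P[->|xy].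
  by rewrite !subrr normr0 !mulr0.
apply: (@le_trans _ _ (lam * f x)).
  rewrite -{1}(gtr0_norm lam_gt0) -normrM mulrBr ger0_norm.
    by rewrite gerBl stein_step_ge0// (leq_trans vx)// ltnW.
  by rewrite subr_ge0 stein_step_decr// ltnW.
rewrite ler_peMr ?stein_step_ge0// distrC -natrB ?(ltnW xy)// ger0_norm//.
by rewrite ler1n subn_gt0.
Qed.

End StepFunction.

Section StepBounds.
Context {R : realType}.
Variable (lam : R).
Hypothesis lam_gt0 : 0 < lam.

(** As a function of the mean, the upper tail is an antiderivative of the mass at
    [k], which is at most [x^k / k!]. *)
Lemma pois_tail_le k : 1 - pois_cdf lam k <= lam ^+ k.+1 / k.+1`!%:R.
Proof.
pose g (j : nat) : R := (j < k.+1)%:R.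
have supp j : (k.+1 <= j)%N -> g j = 0 by move=> kj; rewrite /g ltnNge kj.
pose h (s : R) := (lam * s) ^+ k.+1 / k.+1`!%:R.
have dlin s : @is_derive R R R s 1 (fun s => lam * s) lam.
  by apply: (is_derive_eq (is_derive_scale lam (is_derive_var s))); rewrite mulr1.
have dh s : @is_derive R R R s 1 h (lam * ((lam * s) ^+ k / k`!%:R)).
  have d1 := @is_derive_chain R (fun u => u ^+ k.+1) _ s _ _
               (is_derive_monom (lam * s) k.+1) (dlin s).
  apply: (is_derive_eq (is_derive_mul d1 (is_derive_const s (k.+1`!%:R^-1)))).
  rewrite factS natrM /=; field.
  by rewrite fact_neq0 addrC natr1 pnatr_eq0.
have dg s : @is_derive R R R s 1 (fun s => 0 - imm lam k.+1 0 g s)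
              (lam * pois (lam * s) k).
  apply: (is_derive_eq (is_derive_sub (is_derive_const s 0) (is_derive_imm lam 0 s supp))).
  rewrite mul0r subr0 sub0r -mulrN; congr (_ * _).
  rewrite /= big_ord_recr big1 /= => [|j _]; last first.
    by rewrite /g !ltnS ltn_ord (ltnW (ltn_ord j)) subrr mul0r.
  by rewrite /g ltnn ltnSn !sub0r add0r mulN1r opprK.
have := @derive_le_increment R _ _ 0 1 _ _ ler01 (fun s _ => dg s) (fun s _ => dh s).
rewrite /h !mulr1 mulr0 [0 ^+ _]exprS mul0r mul0r subr0 imm0// imm1 /g ltn0Sn.
rewrite !sub0r opprK addrC => H.
rewrite (_ : pois_cdf lam k = \sum_(r < k.+1) g r * pois lam r); last first.
  by apply: eq_bigr => j _; rewrite /g ltn_ord mul1r.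
apply: H => s /andP[s0 s1]; rewrite ler_wpM2l ?(ltW lam_gt0)// /pois.
have ls0 : 0 <= lam * s by rewrite mulr_ge0// ltW.
by rewrite ler_piMl ?divr_ge0 ?exprn_ge0// expR_le1 oppr_le0.
Qed.

(** Below the mean the masses increase, so the last one is the largest. *)
Lemma pois_cdf_le_mode v : v%:R <= lam -> pois_cdf lam v <= v.+1%:R * pois lam v.
Proof.
elim: v => [_|v IH vl]; first by rewrite /pois_cdf big_ord_recr big_ord0 /= add0r mul1r.
have vl' : v%:R <= lam by rewrite (le_trans _ vl)// ler_nat.
rewrite pois_cdfS -[v.+2%:R]natr1 mulrDl mul1r lerD2r (le_trans (IH vl'))//.
rewrite ler_wpM2l// -(ler_pM2l lam_gt0) -poisS ler_wpM2r//.
by rewrite pois_ge0// ltW.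
Qed.

(** The left-hand side is [P(N > k) * k! / lam^k]; the two bounds come from
    [pois_tail_le] and from [P(N > k) <= 1]. *)
Lemma stein_zero_le k : lam * stein lam (fun j => (j <= 0)%:R) (pois_cdf lam 0) k
  <= Num.min (lam / k.+1%:R) (k`!%:R / lam ^+ k).
Proof.
have F0 : pois_cdf lam 0 = expR (- lam).
  by rewrite /pois_cdf big_ord_recr big_ord0 /= add0r /pois expr0 fact0 divr1 mulr1.
rewrite stein_stepE// F0 /pois.
have -> : expR (- lam) * (1 - pois_cdf lam k) / (expR (- lam) * (lam ^+ k / k`!%:R))
   = (1 - pois_cdf lam k) * (k`!%:R / lam ^+ k).
  by field; rewrite fact_neq0 !gt_eqF ?expR_gt0 ?exprn_gt0.
have q0 : 0 <= k`!%:R / lam ^+ k by rewrite divr_ge0 ?exprn_ge0 ?ltW.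
rewrite le_min; apply/andP; split.
  apply: le_trans (ler_wpM2r q0 (pois_tail_le k)) _.
  rewrite factS natrM exprS [leLHS](_ : _ = lam / k.+1%:R)//.
  by field; rewrite fact_neq0 !gt_eqF ?exprn_gt0//= ltr_wpDl.
rewrite ler_piMl// gerBl ltW// pois_cdf_gt0//.
Qed.

(** Dropping the factor [P(N > v.+1)] leaves [P(N <= v) / P(N = v.+1)], where
    [pois_cdf_le_mode] bounds the numerator. *)
Lemma stein_step_right v : v.+1%:R <= lam ->
  lam * stein lam (fun j => (j <= v)%:R) (pois_cdf lam v) v.+1 <= v.+1%:R ^+ 2 / lam.
Proof.
move=> vl; rewrite stein_stepE//.
have p0 := pois_gt0 v.+1 lam_gt0.
rewrite ler_pdivrMr//.
have F0 := pois_cdf_gt0 v lam_gt0.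
have F1 := pois_cdf_gt0 v.+1 lam_gt0.
apply: (@le_trans _ _ (pois_cdf lam v)); first by rewrite ler_piMr ?(ltW F0)// gerBl ltW.
apply: le_trans (pois_cdf_le_mode _) _; first by rewrite (le_trans _ vl)// ler_nat.
rewrite [leRHS](_ : _ = v.+1%:R / lam * (v.+1%:R * pois lam v.+1)); last by ring.
rewrite poisS [leRHS](_ : _ = v.+1%:R * pois lam v)//.
by field; rewrite gt_eqF.
Qed.

End StepBounds.

(** * Integrals of discrete random variables *)

Section DiscreteIntegral.
Local Open Scope ereal_scope.
Context d (T : measurableType d) (R : realType).
Implicit Types (A : set T).

Lemma eseries_single (a : nat -> \bar R) n :
  (forall k, k != n -> a k = 0) -> \sum_(k <oo) a k = a n.
Proof.
move=> an; apply: lim_near_cst => //; near=> N.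
have nN : (n < N)%N by near: N; exact: nbhs_infty_gt.
rewrite big_mkord (bigD1 (Ordinal nN))//= big1 ?adde0// => k kn.
by apply: an; apply: contra_neq kn => kn; apply/val_inj.
Unshelve. all: by end_near. Qed.

Lemma ge0_integral_disc (mu : {measure set T -> \bar R}) (A : nat -> set T)
    (h : nat -> R) :
  (forall k, measurable (A k)) -> (forall k, (0 <= h k)%R) ->
  \int[mu]_w (\sum_(k <oo) (h k * \1_(A k) w)%:E) = \sum_(k <oo) (h k)%:E * mu (A k).
Proof.
move=> mA h0; rewrite integral_nneseries//; last 2 first.
- by move=> k; apply/measurable_EFinP; apply: measurable_funM.
- by move=> k w _; rewrite lee_fin mulr_ge0// indicE.
apply: eq_eseriesr => k _.
under eq_integral do rewrite EFinM.
rewrite ge0_integralZl_EFin//; last by exact/measurable_EFinP.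
by rewrite integral_indic// setIT.
Qed.

(** Both sides are the same series: its terms are matched by the hypothesis,
    which says that [W] has the law of [X - 1] biased by [X]. *)
Lemma integral_size_bias (mu : {measure set T -> \bar R}) (X : T -> nat)
    (W : T -> int) (lam : R) (phi : nat -> R) :
  (0 <= lam)%R ->
  (forall i, measurable [set w | X w = i]) ->
  (forall i : nat, measurable [set w | W w = i%:Z]) ->
  (forall i : nat, i.+1%:R%:E * mu [set w | X w = i.+1] =
     lam%:E * mu [set w | W w = i%:Z]) ->
  (forall i, (0 <= phi i)%R) ->
  \int[mu]_w ((X w)%:R * phi (X w).-1)%:E =
  lam%:E * \int[mu]_w (phi `|W w|%N * (0 <= W w)%R%:R)%:E.
Proof.
move=> lam0 mX mW bias phi0.
have -> : \int[mu]_w ((X w)%:R * phi (X w).-1)%:E =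
    \int[mu]_w (\sum_(k <oo) (k.+1%:R * phi k * \1_[set w | X w = k.+1] w)%:E).
  apply: eq_integral => w _.
  rewrite (@eseries_single _ (X w).-1) => [|k kX].
    case Xw : (X w) => [|k] /=.
      by rewrite indicE memNset/= ?Xw// mulr0 mul0r.
    by rewrite indicE mem_set// mulr1.
  rewrite indicE memNset ?mulr0//= => Xk.
  by move: kX; rewrite Xk eqxx.
have -> : \int[mu]_w (phi `|W w|%N * (0 <= W w)%R%:R)%:E =
    \int[mu]_w (\sum_(k <oo) (phi k * \1_[set w | W w = k%:Z] w)%:E).
  apply: eq_integral => w _.
  rewrite (@eseries_single _ `|W w|%N) => [|k kW].
    congr (_ * _)%:E; rewrite indicE; congr (_%:R); congr nat_of_bool.
    apply/idP/idP => [W0|]; first by rewrite inE/= gez0_abs.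
    by rewrite inE /= => ->.
  rewrite indicE memNset ?mulr0//= => Wk.
  by move: kW; rewrite Wk eqxx.
rewrite !ge0_integral_disc//; last by move=> k; rewrite mulr_ge0.
rewrite -nneseriesZl//; last by move=> k _; rewrite mule_ge0// lee_fin.
apply: eq_eseriesr => k _.
by rewrite EFinM muleAC bias -muleA [_ * (phi k)%:E]muleC.
Qed.

End DiscreteIntegral.

(** The target spaces are countable with discrete sigma-algebras, so that every
    function of the pair is measurable. *)
Section DiscreteMeasurability.
Context d (T : measurableType d) (R : realType).
Variables (X : T -> nat) (Z : T -> int).
Hypotheses (mX : measurable_fun setT X) (mZ : measurable_fun setT Z).

Lemma measurable_pair_set (B : nat -> int -> Prop) :
  measurable [set w | B (X w) (Z w)].
Proof.
have -> : [set w | B (X w) (Z w)] =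
    \bigcup_n ((X @^-1` [set n]) `&` (Z @^-1` [set z | B n z])).
  apply/seteqP; split => w /=; first by exists (X w).
  by move=> [n _ [/= <-]].
apply: bigcupT_measurable => n; apply: measurableI.
  by rewrite -[X in measurable X]setTI; exact: mX.
by rewrite -[X in measurable X]setTI; exact: mZ.
Qed.

Lemma measurable_pair_fun (h : nat -> int -> R) :
  measurable_fun setT (fun w => h (X w) (Z w)).
Proof.
by move=> _ Y mY; rewrite setTI; exact: (measurable_pair_set (fun n z => Y (h n z))).
Qed.

End DiscreteMeasurability.

(** * The Stein identity *)

Section SteinBound.
Context d (T : measurableType d) (R : realType) (P : probability T R).
Variables (X : T -> nat) (Z : T -> int) (lam : R).
Hypotheses (mX : measurable_fun setT X) (mZ : measurable_fun setT Z).
Hypothesis lam_gt0 : 0 < lam.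
Hypothesis EX : (\int[P]_w ((X w)%:R)%:E = lam%:E)%E.
Hypothesis bias : forall i : nat, (i.+1%:R%:E * P [set w | X w = i.+1] =
     lam%:E * P [set w | ((X w)%:Z + Z w = i%:Z)%R])%E.

Let W w : int := (X w)%:Z + Z w.
Let pos w : R := (0 <= W w)%R%:R.

Let integrable_of (h : nat -> int -> R) (g : T -> R) :
  P.-integrable setT (EFin \o g) ->
  (forall w, `|h (X w) (Z w)| <= `|g w|) ->
  P.-integrable setT (fun w => (h (X w) (Z w))%:E).
Proof.
move=> ig hg; apply: (le_integrable measurableT _ _ ig).
  by apply/measurable_EFinP; exact: measurable_pair_fun.
by move=> w _ /=; rewrite lee_fin.
Qed.

Let iX : P.-integrable setT (EFin \o (fun w => (X w)%:R : R)).
Proof.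
apply/integrableP; split.
  apply/measurable_EFinP.
  exact: (measurable_pair_fun mX mZ (fun n _ => n%:R)).
have -> : (\int[P]_w `|(EFin \o (fun w => (X w)%:R)) w| = lam%:E)%E.
  by rewrite -EX; apply: eq_integral => w _ /=; rewrite ger0_norm.
exact: ltry.
Qed.

Let i1 : P.-integrable setT (EFin \o (fun _ : T => 1 : R)).
Proof. exact: finite_measure_integrable_cst. Qed.

Let bounded_int (h : nat -> int -> R) : (forall n z, `|h n z| <= 1) ->
  P.-integrable setT (fun w => (h (X w) (Z w))%:E).
Proof. by move=> h1; apply: (integrable_of i1) => w; rewrite normr1. Qed.

Let size_bias_ge0 (phi : nat -> R) : (forall i, 0 <= phi i) ->
  (\int[P]_w ((X w)%:R * phi (X w).-1)%:E =
   lam%:E * \int[P]_w (phi `|W w|%N * pos w)%:E)%E.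
Proof.
move=> phi0; apply: integral_size_bias => //.
- exact: ltW.
- by move=> i; exact: (measurable_pair_set mX mZ (fun n _ => n = i)).
- by move=> i; exact: (measurable_pair_set mX mZ (fun n z => n%:Z + z = i%:Z)).
Qed.

Let ipos : P.-integrable setT (EFin \o pos).
Proof.
suff hb (n : nat) (z : int) : `|(0 <= n%:Z + z)%R%:R : R| <= 1.
  exact: (bounded_int hb).
by rewrite normr_nat lern1 leq_b1.
Qed.

(* Total masses in the size-bias identity: [X + Z >= 0] almost surely. *)
Let int_pos : \int[P]_w pos w = 1.
Proof.
have := @size_bias_ge0 (fun=> 1) (fun=> ler01).
under eq_integral do rewrite mulr1.
under [in X in _ = X -> _]eq_integral do rewrite mul1r.
rewrite EX /Rintegral => h.
have : (lam%:E * 1 = lam%:E * \int[P]_w (pos w)%:E)%E by rewrite mule1.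
have fin : (\int[P]_w (pos w)%:E)%E \is a fin_num.
  exact: (integrable_fin_num measurableT ipos).
rewrite -(fineK fin) -!EFinM => -[] /mulfI <- //.
by rewrite gt_eqF.
Qed.

Let ifX (f : nat -> R) : (forall i, `|f i| <= 1) ->
  P.-integrable setT (EFin \o (fun w => f (X w))).
Proof. by move=> f1; exact: (bounded_int (h := fun n _ => f n)). Qed.

Let iXf (f : nat -> R) : (forall i, `|f i| <= 1) ->
  P.-integrable setT (EFin \o (fun w => (X w)%:R * f (X w).-1)).
Proof.
move=> f1; apply: (integrable_of (h := fun n _ => n%:R * f n.-1) iX) => w.
by rewrite normrM ler_piMr.
Qed.

Let ifXpos (f : nat -> R) : (forall i, `|f i| <= 1) ->
  P.-integrable setT (EFin \o (fun w => f (X w) * pos w)).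
Proof.
move=> f1; suff hb n (z : int) : `|f n * (0 <= n%:Z + z)%R%:R| <= 1.
  exact: (bounded_int hb).
by rewrite normrM -[leRHS]mulr1 ler_pM// normr_nat lern1 leq_b1.
Qed.

Let ifWpos (f : nat -> R) : (forall i, `|f i| <= 1) ->
  P.-integrable setT (EFin \o (fun w => f `|W w|%N * pos w)).
Proof.
move=> f1; suff hb n (z : int) : `|f (absz (n%:Z + z)) * (0 <= n%:Z + z)%R%:R| <= 1.
  exact: (bounded_int hb).
by rewrite normrM -[leRHS]mulr1 ler_pM// normr_nat lern1 leq_b1.
Qed.

(** The size-bias identity for the nonnegative [f + 1], minus the one for [1]. *)
Lemma stein_identity (f : nat -> R) : (forall i, `|f i| <= 1) ->
  \int[P]_w ((X w)%:R * f (X w).-1) = lam * \int[P]_w (f `|W w|%N * pos w).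
Proof.
move=> f1.
have f0 i : 0 <= f i + 1.
  by have := f1 i; rewrite ler_norml => /andP[h _]; rewrite -lerBlDr sub0r.
have := @size_bias_ge0 (fun i => f i + 1) f0.
have ia := iXf f1.
have ib := ifWpos f1.
have ibp : P.-integrable setT (EFin \o (fun w => (f `|W w|%N + 1) * pos w)).
  apply: eq_integrable (integrableD measurableT ib ipos) => // w _ /=.
  by rewrite mulrDl mul1r EFinD.
move=> /(congr1 fine); rewrite fineM//; last exact: (integrable_fin_num measurableT ibp).
rewrite -![fine (\int[P]_w _%:E)%E]/(Rintegral _ _ _) /=.
under eq_Rintegral do rewrite mulrDr mulr1.
under [in X in _ = X -> _]eq_Rintegral do rewrite mulrDl mul1r.
rewrite !RintegralD// int_pos mulrDr mulr1.
have -> : \int[P]_w (X w)%:R = lam by rewrite /Rintegral EX.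
by move/addIr.
Qed.

Let int_cst (c : R) : \int[P]_w c = c.
Proof. by rewrite /Rintegral integral_cst//= probability_setT mule1. Qed.

(** Solving the Stein equation for [g] expresses [g(X)] by a bounded function of
    [X] and [X] times another one, even if [g] is unbounded. *)
Lemma integrable_stein (f g : nat -> R) mu : (forall i, `|f i| <= 1) ->
  (forall i, lam * f i - i%:R * f i.-1 = g i - mu) ->
  P.-integrable setT (EFin \o (g \o X)) /\
  \int[P]_w g (X w) = mu + lam * \int[P]_w f (X w) - \int[P]_w ((X w)%:R * f (X w).-1).
Proof.
move=> f1 fg.
have gE w : g (X w) = (mu + lam * f (X w)) - (X w)%:R * f (X w).-1.
  by rewrite -addrA fg addrC subrK.
have ia := iXf f1.
have ib := ifX f1.
have ic : P.-integrable setT (EFin \o (fun w => lam * f (X w))).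
  exact: (integrableZl measurableT lam ib).
have im : P.-integrable setT (EFin \o (fun _ : T => mu)).
  exact: finite_measure_integrable_cst.
have id : P.-integrable setT (EFin \o (fun w => mu + lam * f (X w))).
  exact: (integrableD measurableT im ic).
split.
  apply: eq_integrable (integrableB measurableT id ia) => // w _ /=.
  by rewrite gE.
under eq_Rintegral do rewrite gE.
by rewrite RintegralB// RintegralD// RintegralZl// int_cst.
Qed.

(** The event [X + Z < 0] is negligible, by [int_pos]. *)
Lemma Rintegral_pos_part (f : nat -> R) : (forall i, `|f i| <= 1) ->
  \int[P]_w f (X w) = \int[P]_w (f (X w) * pos w).
Proof.
move=> f1.
have ib := ifX f1.
have ic := ifXpos f1.
have i1p : P.-integrable setT (EFin \o (fun w => 1 - pos w)).
  exact: (integrableB measurableT i1 ipos).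
have id : P.-integrable setT (EFin \o (fun w => f (X w) - f (X w) * pos w)).
  exact: (integrableB measurableT ib ic).
apply/eqP; rewrite -subr_eq0 -RintegralB// -normr_le0.
apply: le_trans (le_normr_Rintegral measurableT id) _.
apply: (@le_trans _ _ (\int[P]_w (1 - pos w))).
  apply: le_Rintegral => //; first exact: (integrable_norm id).
  move=> w _; rewrite -[X in X - _]mulr1 -mulrBr normrM.
  have p1 : 0 <= 1 - pos w by rewrite subr_ge0 lern1 leq_b1.
  by rewrite (ger0_norm p1) ler_piMl.
by rewrite RintegralB// int_pos int_cst subrr.
Qed.

(** The distance to the mean [mu] is [lam * E (f (X) - f (X + Z))] by the Stein
    equation, and the increment of [f] has [`|Z|] steps starting at
    [min (X, X + Z) = X - Z^-]. *)
Lemma stein_bound (f g : nat -> R) (D : int -> R) mu : (forall i, `|f i| <= 1) ->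
  (forall i, lam * f i - i%:R * f i.-1 = g i - mu) ->
  (forall i, 0 <= D i) ->
  (forall x y, lam * `|f x - f y| <= D (minn x y)%:Z * `|x%:R - y%:R|) ->
  (`|\int[P]_w g (X w) - mu|%:E <=
   \int[P]_w (`|Z w|%:~R * D ((X w)%:Z - Z^\- w))%:E)%E.
Proof.
move=> f1 fg D0 fD.
have [_ ->] := integrable_stein f1 fg.
rewrite stein_identity// Rintegral_pos_part//.
pose q w := f (X w) * pos w - f `|W w|%N * pos w.
have ib := ifWpos f1.
have ic := ifXpos f1.
have iq : P.-integrable setT (EFin \o q).
  exact: (integrableB measurableT ic ib).
have ilq : P.-integrable setT (EFin \o (fun w => lam * q w)).
  exact: (integrableZl measurableT lam iq).
rewrite addrAC [mu + _]addrC addrK -mulrBr -RintegralB// -RintegralZl//.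
rewrite EFin_normr_Rintegral//.
apply: le_trans (le_abse_integral _ measurableT _) _.
  by case/integrableP: ilq.
apply: ge0_le_integral => //.
- apply/measurable_EFinP.
  apply: measurableT_comp => //.
  exact: (measurable_pair_fun mX mZ (fun n z => lam *
    (f n * (0 <= n%:Z + z)%R%:R - f (absz (n%:Z + z)) * (0 <= n%:Z + z)%R%:R))).
- apply/measurable_EFinP.
  exact: (measurable_pair_fun mX mZ (fun n z => `|z|%:~R * D (n%:Z - Order.max (- z) 0))).
move=> w _ /=; rewrite lee_fin /q -mulrBl mulrA normrM.
rewrite /pos; case: (leP 0 (W w)) => [W0|_]; last first.
  by rewrite mulr0n normr0 mulr0 mulr_ge0// ler0z.
rewrite mulr1n normr1 mulr1 normrM (gtr0_norm lam_gt0); apply: le_trans (fD _ _) _.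
have -> : (minn (X w) `|W w|%N)%:Z = (X w)%:Z - Z^\- w.
  by move: W0; rewrite /W /funrneg; lia.
rewrite mulrC ler_wpM2r// -[(X w)%:R]/((X w)%:Z%:~R).
have -> : (`|W w|%N)%:R = (W w)%:~R :> R by rewrite -[in RHS](gez0_abs W0).
by rewrite -mulrzBr -intr_norm /W opprD addrA subrr sub0r normrN.
Qed.

End SteinBound.

(** * Expectations of Poisson variables and Stein factors *)

Section PoissonMean.
Context d (T : measurableType d) (R : realType) (Q : probability T R).
Variables (Y : {RV Q >-> nat}) (lam : R).
Hypothesis lam_gt0 : 0 < lam.
Hypothesis Y_poisson : is_poisson Y lam.
Implicit Types (g h w : nat -> R) (n k : nat).

Let mY : measurable_fun setT Y := measurable_funPT Y.

Let mcst : measurable_fun setT (fun _ : T => 0 : int).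
Proof. exact: measurable_cst. Qed.

Let mYh h : measurable_fun setT (fun u => h (Y u)).
Proof. exact: (measurable_pair_fun mY mcst (fun n _ => h n)). Qed.

Let mYset (B : set nat) : measurable [set u | B (Y u)].
Proof. exact: (measurable_pair_set mY mcst (fun n _ => B n)). Qed.

Lemma poisson_mass k : Q [set u | Y u = k] = (pois lam k)%:E.
Proof.
have := Y_poisson [set k]; rewrite /distribution /pushforward /poisson_prob lam_gt0.
rewrite esum_set1 ?lee_fin ?poisson_pmf_ge0// /poisson_pmf lam_gt0 /pois => ->.
by rewrite mulrC.
Qed.

(** The size-biased law of [Y] is that of [Y + 1]; test this identity on a
    constant. *)
Lemma poisson_mean : (\int[Q]_u ((Y u)%:R)%:E = lam%:E)%E.
Proof.
have := @integral_size_bias _ _ R Q Y (fun u => (Y u)%:Z) lam (fun=> 1).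
under eq_integral do rewrite mulr1.
move=> -> //; last 4 first.
- exact: ltW.
- by move=> i; exact: (mYset [set i]).
- by move=> i; exact: (mYset (fun n => n%:Z = i%:Z)).
- move=> i; have -> : [set u | (Y u)%:Z = i%:Z] = [set u | Y u = i].
    by apply/seteqP; split => u /=; [case=> ->|move=> ->].
  transitivity (i.+1%:R%:E * (pois lam i.+1)%:E)%E.
    by congr (_ * _)%E; exact: poisson_mass.
  rewrite -EFinM poisS EFinM; congr (_ * _)%E; exact/esym/poisson_mass.
under eq_integral do rewrite mul1r le0z_nat.
by rewrite integral_cst//= probability_setT !mule1.
Qed.

Lemma poisson_integrable g c : (forall k, `|g k| <= c + k%:R) ->
  Q.-integrable setT (EFin \o (g \o Y)).
Proof.
move=> gc.
have iY : Q.-integrable setT (EFin \o (fun u => (Y u)%:R : R)).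
  apply/integrableP; split; first by apply/measurable_EFinP; exact: mYh.
  have -> : (\int[Q]_u `|(EFin \o (fun u => (Y u)%:R)) u| = lam%:E)%E.
    by rewrite -poisson_mean; apply: eq_integral => u _ /=; rewrite ger0_norm.
  exact: ltry.
have ic : Q.-integrable setT (EFin \o (fun _ : T => c)).
  exact: finite_measure_integrable_cst.
apply: (le_integrable measurableT _ _ (integrableD measurableT ic iY)).
  by apply/measurable_EFinP; exact: mYh.
move=> u _ /=; rewrite lee_fin; apply: le_trans (gc _) _.
exact: ler_norm.
Qed.

Let bounded_integrable g : (forall k, `|g k| <= 1) ->
  Q.-integrable setT (EFin \o (g \o Y)).
Proof.
move=> g1; apply: (@poisson_integrable g 1) => k.
by rewrite (le_trans (g1 k))// lerDl.
Qed.

Lemma poisson_head h n :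
  Q.-integrable setT (EFin \o (fun u => h (Y u) * (Y u < n)%N%:R)) /\
  \int[Q]_u (h (Y u) * (Y u < n)%N%:R) = \sum_(j < n) pois lam j * h j.
Proof.
have ind k : Q.-integrable setT (EFin \o (fun u => (Y u == k)%:R)) /\
    \int[Q]_u (Y u == k)%:R = pois lam k.
  split.
    apply: (bounded_integrable (g := fun j => (j == k)%:R)) => j.
    by rewrite normr_nat lern1 leq_b1.
  have -> : pois lam k = fine (Q [set u | Y u = k]) by rewrite poisson_mass.
  rewrite /Rintegral -[in RHS](setIT [set _ | _]) -integral_indic//; last exact: (mYset [set k]).
  congr fine; apply: eq_integral => u _; rewrite indicE; congr (_%:R%:E); congr nat_of_bool.
  by apply/eqP/idP; rewrite inE.
elim: n => [|n [IH1 IH2]].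
  split.
    apply: (bounded_integrable (g := fun j => h j * (j < 0)%N%:R)) => j.
    by rewrite mulr0 normr0.
  under eq_Rintegral do rewrite mulr0.
  by rewrite big_ord0 /Rintegral integral0.
have [in1 in2] := ind n.
have split_n u : h (Y u) * (Y u < n.+1)%N%:R = h (Y u) * (Y u < n)%N%:R + h n * (Y u == n)%:R.
  rewrite ltnS leq_eqVlt; case: eqP => [->|_] /=.
    by rewrite ltnn mulr0 add0r.
  by rewrite mulr0 addr0.
have ih : Q.-integrable setT (EFin \o (fun u => h n * (Y u == n)%:R)).
  exact: (integrableZl measurableT (h n) in1).
split.
  apply: eq_integrable (integrableD measurableT IH1 ih) => // u _ /=.
  by rewrite split_n.
under eq_Rintegral do rewrite split_n.
by rewrite RintegralD// IH2 RintegralZl// in2 big_ord_recr /= mulrC.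
Qed.

(** Removing the finite sum leaves the integral over [Y >= n], where [w]
    dominates. *)
Lemma poisson_tail h w c n : (forall k, `|h k| <= c + k%:R) ->
  (forall k, `|w k| <= c + k%:R) -> (forall k, (n <= k)%N -> `|h k| <= w k) ->
  `|\int[Q]_u h (Y u) - \sum_(j < n) pois lam j * h j| <=
  \int[Q]_u w (Y u) - \sum_(j < n) pois lam j * w j.
Proof.
move=> hc wc hw.
have ih := poisson_integrable hc; have iw := poisson_integrable wc.
have [ih' <-] := poisson_head h n; have [iw' <-] := poisson_head w n.
rewrite -!RintegralB//.
have ihB := integrableB measurableT ih ih'.
have iwB := integrableB measurableT iw iw'.
apply: le_trans (le_normr_Rintegral measurableT ihB) _.
apply: le_Rintegral => //; first exact: (integrable_norm ihB).
move=> u _; case: (leqP n (Y u)) => nY.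
  by rewrite !mulr0 !subr0 hw.
by rewrite !mulr1 !subrr normr0.
Qed.

Let Rmean : \int[Q]_u (Y u)%:R = lam.
Proof. by rewrite /Rintegral poisson_mean. Qed.

Let int_cst c : \int[Q]_u c = c.
Proof. by rewrite /Rintegral integral_cst//= probability_setT mule1. Qed.

Let iY : Q.-integrable setT (EFin \o (fun u => (Y u)%:R : R)).
Proof.
apply: (@poisson_integrable (fun k => k%:R) 0) => k.
by rewrite add0r normr_nat.
Qed.

Let icst c : Q.-integrable setT (EFin \o (fun _ : T => c)).
Proof. exact: finite_measure_integrable_cst. Qed.

Let int_shift n : \int[Q]_u ((Y u)%:R - n%:R) = lam - n%:R.
Proof. by rewrite RintegralB// Rmean int_cst. Qed.

Let shortfall_sum n :
  \sum_(j < n) pois lam j * (j%:R - n%:R) = - shortfall lam n.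
Proof. by rewrite /shortfall -sumrN; apply: eq_bigr => j _; ring. Qed.

Lemma pois_cdf_le1 n : pois_cdf lam n <= 1.
Proof.
have := @poisson_tail (fun=> 0) (fun=> 1) 1 n.+1.
rewrite !int_cst; under [in X in _ -> _ -> _ -> _ <= X]eq_bigr do rewrite mulr1.
rewrite -/(pois_cdf lam n) => H; rewrite -subr_ge0; apply: le_trans (normr_ge0 _) (H _ _ _) => k.
- by rewrite normr0 addr_ge0.
- by rewrite normr1 lerDl.
- by rewrite normr0.
Qed.

Let abs_shift n k : `|k%:R - n%:R| <= n%:R + k%:R :> R.
Proof. by rewrite (le_trans (ler_normB _ _))// !normr_nat addrC. Qed.

Lemma excess_ge0 n : 0 <= excess lam n.
Proof.
have := @poisson_tail (fun=> 0) (fun k => k%:R - n%:R) n%:R n.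
rewrite int_shift shortfall_sum opprK => H.
have -> : excess lam n = lam - n%:R + shortfall lam n by rewrite /excess; ring.
apply: le_trans (normr_ge0 _) (H _ _ _) => // k; first by rewrite normr0 addr_ge0.
by rewrite normr0 subr_ge0 ler_nat.
Qed.

Section LipschitzTest.
Variable g : nat -> R.
Hypothesis gL : forall x y, `|g x - g y| <= `|x%:R - y%:R|.
Let mu := \int[Q]_u g (Y u).

Lemma Lip1_growth n k : `|g k - g n| <= n%:R + k%:R.
Proof. exact: le_trans (gL _ _) (abs_shift _ _). Qed.

Lemma Lip1_integrable : Q.-integrable setT (EFin \o (g \o Y)).
Proof.
apply: (@poisson_integrable g `|g 0%N|) => k.
rewrite -[X in `|X|](subrK (g 0%N)) addrC (le_trans (ler_normD _ _))// lerD2l.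
by rewrite (le_trans (Lip1_growth 0 k))// add0r.
Qed.

Let mu_shift n : \int[Q]_u (g (Y u) - g n) = mu - g n.
Proof. by rewrite RintegralB// ?int_cst//; exact: Lip1_integrable. Qed.

Lemma head_Lip1 n : `|head_part lam g n| <= shortfall lam n.
Proof.
rewrite (le_trans (ler_norm_sum _ _ _))//; apply: ler_sum => j _.
rewrite normrM ger0_norm ?pois_ge0 ?(ltW lam_gt0)// mulrC ler_wpM2r ?pois_ge0 ?(ltW lam_gt0)//.
by rewrite (le_trans (gL _ _))// distrC ger0_norm// subr_ge0 ler_nat ltnW.
Qed.

Lemma tail_Lip1 n : `|tail_part lam g mu n| <= excess lam n.
Proof.
have := @poisson_tail (fun k => g k - g n) (fun k => k%:R - n%:R) n%:R n.
rewrite int_shift shortfall_sum opprK mu_shift -/(head_part lam g n) -/(tail_part lam g mu n).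
have -> : lam - n%:R + shortfall lam n = excess lam n by rewrite /excess; ring.
apply=> // [k|k nk]; first exact: Lip1_growth.
by rewrite (le_trans (gL _ _))// ger0_norm// subr_ge0 ler_nat.
Qed.

Lemma stein_Lip1_le1 i : `|stein lam g mu i| <= 1.
Proof.
apply: stein_le1 => //; [exact: head_Lip1|exact: tail_Lip1|exact: pois_cdf_le1].
Qed.

Lemma stein_Lip1_lipschitz x y :
  lam * `|stein lam g mu x - stein lam g mu y| <=
  Num.min (11437 / 10000 * Num.sqrt lam) lam * `|x%:R - y%:R|.
Proof.
set c := Num.min _ _.
have slope i : `|stein lam g mu i.+1 - stein lam g mu i| <= c / lam.
  rewrite ler_pdivlMr// mulrC.
  by apply: stein_slope_Lip1 => //; [exact: head_Lip1|exact: tail_Lip1].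
have := Lipschitz_from_slopes x y slope.
by rewrite mulrAC ler_pdivlMr// mulrC.
Qed.

Hypothesis g01 : forall x y, `|g x - g y| <= 1.

(** Summing up to and including [n], where [g - g n] vanishes, leaves the smaller
    tail [P(N > n)]. *)
Lemma tail_bounded n : `|tail_part lam g mu n| <= 1 - pois_cdf lam n.
Proof.
have := @poisson_tail (fun k => g k - g n) (fun=> 1) 1 n.+1.
rewrite int_cst mu_shift; under [in X in _ -> _ -> _ -> _ <= X]eq_bigr do rewrite mulr1.
rewrite big_ord_recr /= subrr mulr0 addr0 -/(head_part lam g n) -/(tail_part lam g mu n).
apply=> [k|k|//]; first by rewrite (le_trans (g01 _ _))// lerDl.
by rewrite normr1 lerDl.
Qed.

Lemma head_bounded i : `|head_part lam g i.+1| <= pois_cdf lam i.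
Proof.
rewrite (le_trans (ler_norm_sum _ _ _))//; apply: ler_sum => j _.
by rewrite normrM ger0_norm ?pois_ge0 ?(ltW lam_gt0)// ler_piMr// pois_ge0// ltW.
Qed.

Lemma stein_indic_lipschitz x y :
  lam * `|stein lam g mu x - stein lam g mu y| <= Num.min 1 lam * `|x%:R - y%:R|.
Proof.
have slope i : `|stein lam g mu i.+1 - stein lam g mu i| <= Num.min 1 lam / lam.
  rewrite ler_pdivlMr// mulrC le_min stein_slope_indic ?head_bounded ?tail_bounded ?excess_ge0//=.
  apply: le_trans (stein_slope_Lip1 lam_gt0 (head_Lip1 _) (tail_Lip1 _)) _.
  by rewrite ge_min lexx orbT.
have := Lipschitz_from_slopes x y slope.
by rewrite mulrAC ler_pdivlMr// mulrC.
Qed.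

End LipschitzTest.

Lemma poisson_cdf v : \int[Q]_u (Y u <= v)%N%:R = pois_cdf lam v.
Proof.
have [_] := poisson_head (fun=> 1) v.+1.
under eq_Rintegral do rewrite mul1r ltnS.
by move=> ->; apply: eq_bigr => j _; rewrite mulr1.
Qed.

End PoissonMean.

(** * The four estimates *)

Section Assembly.
Context d (T : measurableType d) (R : realType) (P : probability T R).

Lemma probability_RintegralE (X : {RV P >-> nat}) (B : pred nat) :
  P [set w | B (X w)] = (\int[P]_w (B (X w))%:R)%:E.
Proof.
have mB : measurable [set w | B (X w)].
  have m0 : measurable_fun setT (fun _ : T => 0 : int) by exact: measurable_cst.
  exact: (measurable_pair_set (measurable_funPT X) m0 (fun n _ => B n)).
rewrite /Rintegral fineK; last first.
  rewrite (_ : (\int[P]_w _)%E = (\int[P]_w (\1_[set w | B (X w)] w)%:E)%E).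
    by rewrite integral_indic// setIT fin_num_measure.
  by apply: eq_integral => w _; rewrite indicE mem_setE.
rewrite -[in LHS](setIT [set _ | _]) -integral_indic//.
by apply: eq_integral => w _; rewrite indicE mem_setE.
Qed.

Lemma ge0_integral_combination (m : nat) (a : R) (c : nat -> R) (h : T -> R)
    (hs : nat -> T -> R) :
  0 <= a -> (forall k, 0 <= c k) -> measurable_fun setT h ->
  (forall k, measurable_fun setT (hs k)) -> (forall w, 0 <= h w) ->
  (forall k w, 0 <= hs k w) ->
  (\int[P]_w (a * h w + \sum_(0 <= k < m) c k * hs k w)%:E =
   a%:E * \int[P]_w (h w)%:E +
   \sum_(0 <= k < m) (c k)%:E * \int[P]_w (hs k w)%:E)%E.
Proof.
move=> a0 c0 mh mhs h0 hs0.
have mZ (e : R) (u : T -> R) : measurable_fun setT u ->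
    measurable_fun setT (fun w => (e * u w)%:E).
  by move=> mu; apply/measurable_EFinP; exact: measurable_funM.
under eq_integral do rewrite EFinD -sumEFin.
rewrite ge0_integralD//.
- congr (_ + _)%E.
    by rewrite -ge0_integralZl_EFin// => [w _|]; [rewrite lee_fin|exact/measurable_EFinP].
  rewrite ge0_integral_sum//.
  + apply: eq_bigr => k _; rewrite -ge0_integralZl_EFin// => [w _|].
      by rewrite lee_fin.
    exact/measurable_EFinP.
  + by move=> k; exact: mZ.
  + by move=> k w _; rewrite lee_fin mulr_ge0.
- by move=> w _; rewrite lee_fin mulr_ge0.
- exact: mZ.
- by move=> w _; rewrite sume_ge0// => k _; rewrite lee_fin mulr_ge0.
- by apply: emeasurable_sum => k; exact: mZ.
Qed.

End Assembly.

Theorem theorem1p1 (R : realType)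
    (d : measure_display) (T : measurableType d) (P : probability T R)
    (X : {RV P >-> nat}) (Z : {RV P >-> int}) (lambda : R)
    (d' : measure_display) (T' : measurableType d') (Q : probability T' R)
    (Y : {RV Q >-> nat})
    (lambda_gt0 : 0 < lambda)
    (EX : ('E_P[fun w => (X w)%:R] = lambda%:E)%E)
    (Y_poisson : is_poisson Y lambda)
    (XZ : forall i : nat, (0 < i)%N ->
      (i%:R%:E * P [set w | X w = i] =
       lambda%:E * P [set w | ((X w)%:Z + Z w = i%:Z - 1)%R])%E) :
  [/\ (dTV X Y <= (Num.min 1 lambda)%:E * 'E_P[fun w => `|Z w|%:~R])%E,
      (dW X Y <= (Num.min (11437 / 10000 * Num.sqrt lambda) lambda)%:E
                 * 'E_P[fun w => `|Z w|%:~R])%E,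
      forall m : nat,
        (`|P [set w | X w = 0%N] - Q [set w | Y w = 0%N]| <=
         (m`!%:R / lambda ^+ m)%:E * 'E_P[fun w => `|Z w|%:~R]
         + \sum_(0 <= k < m)
             (Num.min (lambda / (k.+1)%:R) (k`!%:R / lambda ^+ k))%:E
             * 'E_P[fun w => (`|Z w|%:~R
                 * \1_[set w | ((X w)%:Z - Z^\- w = k%:Z)%R] w)%R])%E
    & forall v : nat, (0 < v)%N ->
        (`|P [set w | (X w <= v)%N] - Q [set w | (Y w <= v)%N]| <=
         ((v.+1)%:R ^+ 2 / lambda)%:E * 'E_P[fun w => `|Z w|%:~R]
         + 'E_P[fun w => (`|Z w|%:~R
             * \1_[set w | ((X w)%:Z - Z^\- w <= v%:Z)%R] w)%R])%E].
Proof.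
have mX : measurable_fun setT X := measurable_funPT X.
have mZ : measurable_fun setT Z := measurable_funPT Z.
have EX' : (\int[P]_w ((X w)%:R)%:E = lambda%:E)%E by rewrite -EX unlock.
have bias (i : nat) : (i.+1%:R%:E * P [set w | X w = i.+1] =
    lambda%:E * P [set w | ((X w)%:Z + Z w = i%:Z)%R])%E.
  by rewrite XZ//; do 3 f_equal; apply/seteqP; split=> w /=; lia.
pose zeta w : R := `|Z w|%:~R.
have zeta0 w : 0 <= zeta w by rewrite ler0z.
have mzeta : measurable_fun setT zeta.
  exact: (measurable_pair_fun mX mZ (fun _ z => `|z|%:~R)).
have bound (g : nat -> R) (D : int -> R) mu :
    (forall x y, `|g x - g y| <= `|x%:R - y%:R|) ->
    mu = \int[Q]_w g (Y w) -> (forall i, 0 <= D i) ->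
    (forall x y, lambda * `|stein lambda g mu x - stein lambda g mu y| <=
       D (minn x y)%:Z * `|x%:R - y%:R|) ->
    (`|\int[P]_w g (X w) - \int[Q]_w g (Y w)|%:E <=
      \int[P]_w (zeta w * D ((X w)%:Z - Z^\- w))%:E)%E.
  move=> gL muE D0 fD; rewrite -muE.
  apply: (stein_bound mX mZ lambda_gt0 EX' bias _ (@steinE R lambda lambda_gt0 g mu)) => //.
  by move=> i; rewrite muE; apply: (stein_Lip1_le1 lambda_gt0 Y_poisson).
have const c : 0 <= c ->
    (\int[P]_w (zeta w * c)%:E = c%:E * 'E_P[fun w => `|Z w|%:~R])%E.
  move=> c0; rewrite unlock -ge0_integralZl_EFin//; last exact/measurable_EFinP.
  by apply: eq_integral => w _; rewrite mulrC.
have indic01 (B : pred nat) x y : `|(B x)%:R - (B y)%:R| <= 1 :> R.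
  by case: (B x); case: (B y); rewrite ?subrr ?subr0 ?sub0r ?normrN ?normr0 ?normr1.
(* Indicators are [1]-Lipschitz, as distinct integers are at distance at least
   [1]. *)
have indicL (B : pred nat) x y : `|(B x)%:R - (B y)%:R| <= `|x%:R - y%:R| :> R.
  have [->|xy] := eqVneq x y; first by rewrite !subrr.
  apply: le_trans (indic01 B x y) _.
  wlog lt_xy : x y xy / (x < y)%N.
    move=> H; case: (ltngtP x y) => [||e]; first exact: H.
    - by move=> yx; rewrite distrC; apply: H => //; rewrite eq_sym.
    - by rewrite e eqxx in xy.
  by rewrite distrC -natrB ?(ltnW lt_xy)// normr_nat ler1n subn_gt0.
have probB (B : pred nat) : (`|P [set w | B (X w)] - Q [set w | B (Y w)]| =
    `|\int[P]_w (B (X w))%:R - \int[Q]_w (B (Y w))%:R|%:E)%E.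
  by rewrite !probability_RintegralE -EFinB.
have min0 : 0 <= Num.min 1 lambda by rewrite le_min ler01 ltW.
have ex0 := excess_ge0 lambda_gt0 Y_poisson.
have cdf1 := pois_cdf_le1 lambda_gt0 Y_poisson.
have indicD (B : pred nat) x y :=
  stein_indic_lipschitz lambda_gt0 Y_poisson (indicL B) (indic01 B) x y.
split.
- apply: ge_ereal_sup => _ [A _ <-].
  have setE U (V : U -> nat) : V @^-1` A = [set w | (V w \in A)].
    by apply/seteqP; split => w /=; rewrite inE.
  rewrite !setE (probB (fun k => k \in A)) -const//.
  by apply: (bound _ (fun=> Num.min 1 lambda) _ (indicL _) erefl) => //; exact: indicD.
- apply: ge_ereal_sup => _ [g gL <-].
  set c := Num.min _ _.
  have c0 : 0 <= c.
    by rewrite le_min (ltW lambda_gt0) andbT; apply: mulr_ge0; [lra|exact: sqrtr_ge0].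
  have [iX _] := integrable_stein mX mZ EX'
    (stein_Lip1_le1 lambda_gt0 Y_poisson gL) (@steinE R lambda lambda_gt0 g _).
  have iY := Lip1_integrable lambda_gt0 Y_poisson gL.
  have -> : ('E_P[g \o X] = (\int[P]_w g (X w))%:E)%E.
    by rewrite unlock /Rintegral fineK//; exact: integrable_fin_num iX.
  have -> : ('E_Q[g \o Y] = (\int[Q]_w g (Y w))%:E)%E.
    by rewrite unlock /Rintegral fineK//; exact: integrable_fin_num iY.
  rewrite -EFinB -(const c c0).
  apply: (bound _ (fun=> c) _ gL erefl (fun=> c0)).
  exact: (stein_Lip1_lipschitz lambda_gt0 Y_poisson gL).
- move=> m.
  have eq0 U (V : U -> nat) : [set w | V w = 0%N] = [set w | (V w <= 0)%N].
    by apply/seteqP; split => w /=; rewrite leqn0 => /eqP.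
  rewrite !eq0 (probB (fun k => k <= 0)%N).
  (* [X - Z^-] is negative only where [X + Z] is: [D] vanishes there to stay
     below the indicators in the sum. *)
  pose c k : R := Num.min (lambda / k.+1%:R) (k`!%:R / lambda ^+ k).
  pose D (z : int) : R :=
    if z is Posz k then if (k < m)%N then c k else m`!%:R / lambda ^+ m else 0.
  have f0 k : 0 <= k`!%:R / lambda ^+ k by rewrite divr_ge0// exprn_ge0// ltW.
  have c0 k : 0 <= c k by rewrite le_min f0 divr_ge0// ltW.
  have D0 z : 0 <= D z by rewrite /D; case: z => // k; case: ifP.
  have main := bound (fun k => (k <= 0)%N%:R) D _ (indicL (fun k => k <= 0)%N)
    (esym (poisson_cdf lambda_gt0 Y_poisson 0)) D0.
  apply: le_trans (main _) _ => {main}.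
    move=> x y; apply: le_trans (stein_step_diff lambda_gt0 ex0 cdf1 (leq0n _)) _.
    rewrite ler_wpM2r// /D; case: ltnP => k.
      exact: stein_zero_le.
    apply: le_trans (stein_step_decr lambda_gt0 ex0 (leq0n m) k) _.
    apply: le_trans (stein_zero_le lambda_gt0 m) _.
    by rewrite ge_min lexx orbT.
  pose hs k w : R := zeta w * \1_[set w | ((X w)%:Z - Z^\- w = k%:Z)%R] w.
  have mhs k : measurable_fun setT (hs k).
    apply: measurable_funM => //; apply: measurable_indic.
    exact: (measurable_pair_set mX mZ (fun n z => n%:Z - Order.max (- z) 0 = k%:Z)).
  have hs0 k w : 0 <= hs k w by rewrite mulr_ge0.
  rewrite unlock -/zeta -(ge0_integral_combination P m (f0 m) c0 mzeta mhs zeta0 hs0).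
  apply: ge0_le_integral => //.
  + by move=> w _; rewrite lee_fin mulr_ge0.
  + apply/measurable_EFinP.
    exact: (measurable_pair_fun mX mZ (fun n z => `|z|%:~R * D (n%:Z - Order.max (- z) 0))).
  + apply/measurable_EFinP; apply: measurable_funD; first exact: measurable_funM.
    by apply: measurable_sum => k; exact: measurable_funM.
  move=> w _; rewrite lee_fin.
  have s0 : 0 <= \sum_(0 <= k < m) c k * hs k w by apply: sumr_ge0 => k _; rewrite mulr_ge0.
  case E : ((X w)%:Z - Z^\- w) => [k|k] /=; last by rewrite mulr0 addr_ge0// mulr_ge0.
  case: ifPn => km; last by rewrite mulrC lerDl.
  rewrite big_mkord (bigD1 (Ordinal km))//= {1}/hs indicE mem_set// mulr1 addrCA mulrC lerDl.
  by apply: addr_ge0; [exact: mulr_ge0|apply: sumr_ge0 => j _; exact: mulr_ge0].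
- move=> v v0; rewrite (probB (fun k => k <= v)%N).
  pose D (z : int) : R :=
    if z is Posz k then if (k <= v)%N then 1 else v.+1%:R ^+ 2 / lambda else 0.
  have f0 : 0 <= v.+1%:R ^+ 2 / lambda by rewrite divr_ge0 ?sqr_ge0// ltW.
  have D0 z : 0 <= D z by rewrite /D; case: z => // k; case: ifP.
  have le1 x y : lambda * `|stein lambda (fun k => (k <= v)%N%:R) (pois_cdf lambda v) x
      - stein lambda (fun k => (k <= v)%N%:R) (pois_cdf lambda v) y| <= `|x%:R - y%:R|.
    rewrite -(poisson_cdf lambda_gt0 Y_poisson v).
    apply: le_trans (indicD (fun k => k <= v)%N x y) _.
    by rewrite ler_piMl// ge_min lexx.
  have main := bound (fun k => (k <= v)%N%:R) D _ (indicL (fun k => k <= v)%N)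
    (esym (poisson_cdf lambda_gt0 Y_poisson v)) D0.
  apply: le_trans (main _) _ => {main}.
    move=> x y; rewrite /D; case: ifPn => [_|]; first by rewrite mul1r.
    rewrite -ltnNge => vk.
    (* For small means the claimed factor exceeds the slope bound [1]. *)
    have [lv|lv] := leP lambda v.+1%:R.
      apply: le_trans (le1 x y) _; rewrite ler_peMl// ler_pdivlMr// mul1r.
      by rewrite (le_trans lv)// expr2 ler_peMl// ler1n.
    apply: le_trans (stein_step_diff lambda_gt0 ex0 cdf1 (ltnW vk)) _.
    rewrite ler_wpM2r//.
    apply: le_trans (stein_step_decr lambda_gt0 ex0 (leqnSn v) vk) _.
    exact/stein_step_right/ltW.
  pose hs (k : nat) w : R := zeta w * \1_[set w | ((X w)%:Z - Z^\- w <= v%:Z)%R] w.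
  have mhs k : measurable_fun setT (hs k).
    apply: measurable_funM => //; apply: measurable_indic.
    exact: (measurable_pair_set mX mZ (fun n z => n%:Z - Order.max (- z) 0 <= v%:Z)).
  have hs0 k w : 0 <= hs k w by rewrite mulr_ge0.
  have := ge0_integral_combination P 1 f0 (fun=> ler01) mzeta mhs zeta0 hs0.
  rewrite big_nat1 mul1e => rhsE.
  rewrite unlock [leRHS](_ : _ = \int[P]_w (v.+1%:R ^+ 2 / lambda * zeta w
    + \sum_(0 <= k < 1) 1 * hs k w)%:E)%E; last exact/esym/rhsE.
  apply: ge0_le_integral => //.
  + by move=> w _; rewrite lee_fin mulr_ge0.
  + apply/measurable_EFinP.
    exact: (measurable_pair_fun mX mZ (fun n z => `|z|%:~R * D (n%:Z - Order.max (- z) 0))).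
  + apply/measurable_EFinP; apply: measurable_funD; first exact: measurable_funM.
    by apply: measurable_sum => k; exact: measurable_funM.
  move=> w _; rewrite lee_fin big_nat1 mul1r.
  case E : ((X w)%:Z - Z^\- w) => [k|k] /=; last by rewrite mulr0 addr_ge0// mulr_ge0.
  case: ifPn => km; last by rewrite mulrC lerDl.
  have -> : hs 0%N w = zeta w by rewrite /hs indicE mem_set ?mulr1//= E lez_nat.
  by rewrite mulr1 lerDr; exact: mulr_ge0.
Qed.
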